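(* Let $x^{(0)}\in\mathcal{X}$, $u_1^{(0)}\in\mathcal{U}_1,\ldots,u_M^{(0)}\in\mathcal{U}_M$. Set $\tilde{s}^{(0)}=x^{(0)}+\tau\sum_{m=1}^ML_m^*u_m^{(0)}$. Let $\tau\in(0,2/\beta)$ and $\sigma_1>0,\ldots,\sigma_M>0$ be such that $\tau\big\|\sum_{m=1}^M\sigma_mL_m^*L_m\big\|<1$. Set $\delta=2-\tau\beta/2$. Let $(\rho^{(i)})_{i\in\mathbb{N}}$ be a sequence in $[0,\delta]$ such that $\sum_{i\in\mathbb{N}}\rho^{(i)}(\delta-\rho^{(i)})=+\infty$. Consider the iteration, for $i=0,1,\ldots$, $$\begin{aligned}a^{(i)}&=x^{(i)}-\tau\nabla h(x^{(i)})-\tilde{s}^{(i)},\\ \tilde{s}^{(i+1)}&=\tilde{s}^{(i)}+\rho^{(i)}a^{(i)},\\ u_m^{(i+1)}&=u_m^{(i)}+\rho^{(i)}\Big(\mathrm{prox}_{\sigma_mg_m^*}\big(u_m^{(i)}+\sigma_mL_m(x^{(i)}+a^{(i)})\big)-u_m^{(i)}\Big),\quad m=1,\ldots,M,\\ x^{(i+1)}&=\tilde{s}^{(i+1)}-\tau\sum_{m=1}^ML_m^*u_m^{(i+1)}.\end{aligned}$$ Then $(x^{(i)})_{i\in\mathbb{N}}$ converges weakly to a solution of the primal problem of minimizing $\sum_{m=1}^Mg_m(L_mx)+h(x)$ over $x\in\mathcal{X}$, and $\big((u_1^{(i)},\ldots,u_M^{(i)})\big)_{i\in\mathbb{N}}$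 converges weakly to a solution of the dual problem of minimizing $\sum_{m=1}^Mg_m^*(u_m)+h^*\big(-\sum_{m=1}^ML_m^*u_m\big)$ over $(u_1,\ldots,u_M)\in\mathcal{U}_1\times\cdots\times\mathcal{U}_M$.
   Context: $M\ge1$ is an integer; $\mathcal{X}$ and $\mathcal{U}_1,\ldots,\mathcal{U}_M$ are real Hilbert spaces. For a real Hilbert space $\mathcal{H}$, $\Gamma_0(\mathcal{H})$ is the set of convex, proper, lower semicontinuous functions from $\mathcal{H}$ to $\mathbb{R}\cup\{+\infty\}$; for $\varphi\in\Gamma_0(\mathcal{H})$, $\varphi^*(y)=\sup_{x\in\mathcal{H}}(\langle x,y\rangle-\varphi(x))$ is its conjugate, $\partial\varphi$ its subdifferential, and $\mathrm{prox}_{\varphi}(x)=\operatorname{arg\,min}_{x'\in\mathcal{H}}(\varphi(x')+\frac12\|x'-x\|^2)$. Here $g_m\in\Gamma_0(\mathcal{U}_m)$ and $L_m:\mathcal{X}\to\mathcal{U}_m$ is a bounded linear operator with adjoint $L_m^*$, for $m=1,\ldots,M$; $h:\mathcal{X}\to\mathbb{R}$ is convex and differentiable with $\beta$-Lipschitz continuous gradient for some real $\beta>0$. Standing assumption: there exists $x\in\mathcal{X}$ with $0\in\sum_{m=1}^ML_m^*\partial g_m(L_mx)+\nabla h(x)$. *)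

(* Defs.v *)
From HB Require Import structures.
From mathcomp Require Export all_boot all_order all_algebra sesquilinear.
From mathcomp Require Export all_classical all_reals all_analysis.

Set Implicit Arguments.
Unset Strict Implicit.
Unset Printing Implicit Defensive.

Import Order.TTheory GRing.Theory Num.Theory.
Import numFieldNormedType.Exports.

Local Open Scope classical_set_scope.
Local Open Scope ring_scope.

HB.mixin Record CompleteNormedModule_isHilbert (R : realType) H
    & CompleteNormedModule R H := {
  inner : {dot H for (@idfun R)} ;
  sqr_norm_inner : forall x : H, `|x| ^+ 2 = inner x x
}.

#[short(type="hilbertType")]
HB.structure Definition Hilbert (R : realType) :=
  {H of CompleteNormedModule R H & CompleteNormedModule_isHilbert R H}.

Notation "''[' x , y ]" := (inner x%R y%R) : ring_scope.

(* The inner product of the Hilbert direct sum of the U m. *)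
Definition prod_inner (R : realType) (M : nat) (U : 'I_M -> hilbertType R)
    (u v : forall m, U m) : R :=
  \sum_(m < M) '[u m, v m].

(* The inner product is an argument so that the same notion serves for a
   Hilbert space and for a product equipped with prod_inner. *)
Definition weakly_cvg (R : realType) (V : Type) (dot : V -> V -> R)
    (x : nat -> V) (l : V) : Prop :=
  forall v : V, (fun n => dot (x n) v) @ \oo --> dot l v.

Definition argmin (R : realType) (V : Type) (F : V -> \bar R) : set V :=
  [set x | forall y, (F x <= F y)%E].

Definition opnorm (R : realType) (V W : normedModType R) (T : V -> W) : R :=
  sup [set `|T x| | x in [set x | `|x| <= 1]].

(* By Riesz's theorem the set is a singleton if L is bounded linear. *)
Definition adjoint (R : realType) (H G : hilbertType R) (L : H -> G) (u : G)
    : H :=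
  xget 0 [set z | forall x, '[L x, u] = '[x, z]].

(* By Riesz's theorem the set is a singleton if f is differentiable at x. *)
Definition gradient (R : realType) (H : hilbertType R) (f : H -> R^o) (x : H)
    : H :=
  xget 0 [set v | forall z, 'd f x z = '[v, z]].

Section convex_analysis.
Context (R : realType) (H : hilbertType R).
Implicit Types (f : H -> \bar R) (x y : H).
Local Open Scope ereal_scope.

Definition econvex f : Prop :=
  forall x y (t : R), (0 < t < 1)%R ->
    f (t *: x + (1 - t) *: y)%R <= t%:E * f x + (1 - t)%:E * f y.

Definition proper f : Prop :=
  (forall x, f x != -oo) /\ (exists x, f x != +oo).

Definition Gamma0 : set (H -> \bar R) :=
  [set f | [/\ econvex f, proper f & lower_semicontinuous f]].

Definition conjugate f y : \bar R :=
  ereal_sup [set '[x, y]%R%:E - f x | x in [set: H]].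

Definition subdiff f x : set H :=
  [set v | forall y, f x + '[y - x, v]%R%:E <= f y].

(* The argmin is a singleton for f in Gamma0. *)
Definition prox f x : H :=
  xget 0%R (argmin (fun y => f y + (2^-1 * `|y - x| ^+ 2)%:E)).

End convex_analysis.

(* Main.v *)
From HB Require Import structures.
Require Import Defs.
From mathcomp Require Import ring lra.

Set Implicit Arguments.
Unset Strict Implicit.
Unset Printing Implicit Defensive.

Import Order.TTheory GRing.Theory Num.Theory.
Import numFieldNormedType.Exports.

Local Open Scope classical_set_scope.
Local Open Scope ring_scope.

(** Put z = (x, u), where u collects the u_m, and write L^* u for the sum of the
    L_m^* u_m.  Since s = x + tau L^* u along the iteration, one has
    x + a = x - tau grad h(x) - tau L^* u, and the iteration reads
    z' = z + rho (T z - z), where T (x, u) = (x - tau grad h(x) - tau L^* p, p) and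
    p_m = prox_{sigma_m g_m^*} (u_m + sigma_m L_m (x - tau grad h(x) - tau L^* u)).
    This T ([fb_step]) is a forward-backward step for the inclusion
    0 = grad h(x) + L^* u, L_m x \in subdiff g_m^* (u_m), in the inner product
    [metric], which weighs x by tau^-1 and u by sigma^-1 - tau L L^*.  The step
    size condition makes this inner product equivalent to the usual one
    ([metric_coercive], [metric_le]).

    The gradient of h is 1/beta-cocoercive ([gradient_cocoercive], the
    Baillon-Haddad theorem) and the subdifferentials of the g_m^* are monotone.
    Together they show that id + delta (T - id) is nonexpansive
    ([fb_step_averaged], [relaxed_step_nonexpansive]), so that the iteration is a
    Krasnoselskii-Mann iteration with steps rho / delta, whose weights
    rho (delta - rho) / delta^2 have an infinite sum.  Such an iteration converges
    weakly to a fixed point ([krasnoselskii_mann]): the distances to fixed points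
    decrease, the residuals tend to 0, every weak cluster point is therefore a
    fixed point, and Opial's argument leaves room for one cluster point only.

    A fixed point of T is a pair with grad h(x) + L^* u = 0 and
    L_m x \in subdiff g_m^* (u_m) ([fb_step_fixedP]).  Such a u solves the dual
    problem, by the Fenchel-Young equality for h ([saddle_point_dual]).  As
    L_m x \in subdiff g_m^* (u_m) implies u_m \in subdiff g_m (L_m x)
    ([subdiff_conjugateK]), such an x solves the primal problem
    ([saddle_point_primal]).  The standing assumption yields a fixed point, since a
    subgradient u_m of g_m at L_m x satisfies L_m x \in subdiff g_m^* (u_m)
    ([subdiff_conjugate]).

    Completeness enters through a single principle, [strongly_convex_argmin]: a
    strongly convex function that is bounded below and closed has a minimiser.
    It gives Riesz representation in any complete inner product, hence adjoints,
    gradients, functionals in [metric] and weak limits along ultrafilters, and it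
    gives the existence of proximal points. *)

(** * Complete inner products *)

Lemma ge0_of_small_quad {R : realFieldType} (a b : R) :
  (forall t, 0 < t < 1 -> 0 <= t * a + t ^+ 2 * b) -> 0 <= a.
Proof.
move=> ab; rewrite leNgt; apply/negP => a0.
have b0 : 0 < `|b| + 1 by rewrite ltr_wpDl.
pose t := Num.min (2^-1) (- a / (`|b| + 1) / 2).
have t0 : 0 < t by rewrite lt_min !divr_gt0 ?oppr_gt0// invr_gt0; lra.
have t1 : t < 1 by rewrite gt_min; apply/orP; left; lra.
have tb : t * (`|b| + 1) <= - a / 2.
  have : t <= - a / (`|b| + 1) / 2 by rewrite ge_min lexx orbT.
  by rewrite -ler_pdivlMr// mulrAC.
have := ab t; rewrite t0 t1 => /(_ isT).
rewrite (_ : _ + _ = t * (a + t * b)); last by ring.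
rewrite pmulr_rge0// => h.
have : t * b <= t * (`|b| + 1).
  by rewrite ler_pM2l// (le_trans (ler_norm b))// lerDl.
by move=> ?; lra.
Qed.

Section complete_dot.
Context {R : realType} {V : lmodType R}.
Variable dot : V -> V -> R.

Definition dot_cvg (z : nat -> V) (l : V) : Prop :=
  (fun n => dot (z n - l) (z n - l)) @ \oo --> (0 : R).

(** Completeness is a property of the bilinear form alone: it serves for the inner
    product of a Hilbert space and for a second inner product on the same module. *)
Record complete_dot : Prop := CompleteDot {
  dotC : forall x y, dot x y = dot y x ;
  dotP : forall a x y z, dot (a *: x + y) z = a * dot x z + dot y z ;
  dot_ge0 : forall x, 0 <= dot x x ;
  dot_eq0 : forall x, dot x x <= 0 -> x = 0 ;
  dot_complete : forall z : nat -> V,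
    (forall e : R, 0 < e -> exists N, forall m n, (N <= m)%N -> (N <= n)%N ->
      dot (z m - z n) (z m - z n) <= e) ->
    exists l, dot_cvg z l }.

Hypothesis hdot : complete_dot.
Local Notation sq x := (dot x x).

Lemma dotDl x y z : dot (x + y) z = dot x z + dot y z.
Proof. by rewrite -[x]scale1r (dotP hdot) mul1r scale1r. Qed.

Lemma dot0l z : dot 0 z = 0.
Proof. by have := dotDl 0 0 z; rewrite addr0; lra. Qed.

Lemma dotZl a x z : dot (a *: x) z = a * dot x z.
Proof. by rewrite -[a *: x]addr0 (dotP hdot) dot0l addr0. Qed.

Lemma dotNl x z : dot (- x) z = - dot x z.
Proof. by rewrite -scaleN1r dotZl mulN1r. Qed.

Lemma dotBl x y z : dot (x - y) z = dot x z - dot y z.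
Proof. by rewrite dotDl dotNl. Qed.

Lemma dotDr x y z : dot z (x + y) = dot z x + dot z y.
Proof. by rewrite dotC // dotDl !(dotC hdot z). Qed.

Lemma dotZr a x z : dot z (a *: x) = a * dot z x.
Proof. by rewrite dotC // dotZl (dotC hdot z). Qed.

Lemma dotNr x z : dot z (- x) = - dot z x.
Proof. by rewrite dotC // dotNl (dotC hdot z). Qed.

Lemma dotBr x y z : dot z (x - y) = dot z x - dot z y.
Proof. by rewrite dotDr dotNr. Qed.

Lemma sqdotD x y : sq (x + y) = sq x + 2 * dot x y + sq y.
Proof. by rewrite !dotDl !dotDr (dotC hdot y x); ring. Qed.

Lemma sqdotB x y : sq (x - y) = sq x - 2 * dot x y + sq y.
Proof. by rewrite !dotBl !dotBr (dotC hdot y x); ring. Qed.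

Lemma sqdotZ a x : sq (a *: x) = a ^+ 2 * sq x.
Proof. by rewrite dotZl dotZr; ring. Qed.

Lemma young x y t : 0 < t -> 2 * dot x y <= t * sq x + t^-1 * sq y.
Proof.
move=> t0; have := dot_ge0 hdot (t *: x - y).
rewrite sqdotB sqdotZ dotZl => h.
rewrite -(ler_pM2l t0) -subr_ge0.
suff -> : t * (t * sq x + t^-1 * sq y) - t * (2 * dot x y) =
  t ^+ 2 * sq x - 2 * (t * dot x y) + sq y by [].
by field; rewrite gt_eqF.
Qed.

(** Strong convexity is stated at midpoints and through sublevel sets, which
    spares arithmetic with infinite values: two points of the level r have their
    midpoint in a level that is lower by c times their squared distance.  Hence a
    minimising sequence is Cauchy. *)
Lemma strongly_convex_argmin (F : V -> \bar R) (b c : R) : 0 < c ->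
  (forall x, b%:E <= F x)%E -> (exists x r, F x <= r%:E)%E ->
  (forall x y r, F x <= r%:E -> F y <= r%:E ->
    F (2^-1 *: (x + y))%R <= (r - c * sq (x - y))%:E)%E ->
  (forall z l r, dot_cvg z l -> (forall n, F (z n) <= r%:E) -> F l <= r%:E)%E ->
  argmin F !=set0.
Proof.
move=> c0 Fb [x0 [r0 Fx0]] Fmid Fclosed.
pose S := [set r : R | exists x, (F x <= r%:E)%E].
have Sinf : has_inf S.
  split; first by exists r0, x0.
  by exists b => r [x Fx]; rewrite -lee_fin (le_trans (Fb x)).
pose I := inf S.
have IF x r : (F x <= r%:E)%E -> I <= r.
  by move=> Fx; apply: ge_inf; [exact: Sinf.2 | exists x].
have Fz n : exists x, (F x <= (I + n.+1%:R^-1)%:E)%E.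
  have n0 : 0 < n.+1%:R^-1 :> R by rewrite invr_gt0.
  have [r [x Fx] rI] := inf_adherent n0 Sinf.
  by exists x; rewrite (le_trans Fx)// lee_fin ltW.
pose z n := projT1 (cid (Fz n)).
have Fzn n k : (n <= k)%N -> (F (z k) <= (I + n.+1%:R^-1)%:E)%E.
  move=> nk; apply: (le_trans (projT2 (cid (Fz k)))).
  by rewrite lee_fin lerD2l lef_pV2 ?posrE// ler_nat.
have small (e : R) : 0 < e -> exists n : nat, n.+1%:R^-1 <= e.
  move=> e0; have [n _] := near_infty_natSinv_lt (PosNum e0).
  by move=> /(_ n (leqnn n)) /= /ltW; exists n.
have [l zl] : exists l, dot_cvg z l.
  apply: (dot_complete hdot) => e e0.
  have [N Ne] := small _ (mulr_gt0 c0 e0); exists N => m n Nm Nn.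
  have /IF := Fmid _ _ _ (Fzn _ _ Nm) (Fzn _ _ Nn).
  move: Ne; set d := _^-1; set q := dot _ _ => Ne h.
  by rewrite -(ler_pM2l c0); lra.
have Fl : (F l <= I%:E)%E.
  apply/lee_addgt0Pr => e e0; have [n ne] := small _ e0.
  have zln : dot_cvg (fun k => z (k + n)%N) l.
    by have := zl; rewrite /dot_cvg -(cvg_shiftn n).
  apply: (le_trans (Fclosed _ _ (I + n.+1%:R^-1) zln _)).
    by move=> k; apply: Fzn; rewrite leq_addl.
  by rewrite -EFinD lee_fin lerD2l.
exists l => y; case Fy: (F y) => [r| |]; last 2 first.
- by rewrite leey.
- by have := Fb y; rewrite Fy.
- by rewrite (le_trans Fl)// lee_fin; apply: (IF y); rewrite Fy.
Qed.

Lemma dot_cvgl z l v : dot_cvg z l -> (fun n => dot (z n) v) @ \oo --> dot l v.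
Proof.
move=> zl; apply/cvgrPdist_le => e e0.
have v0 : 0 < sq v + 1 by rewrite ltr_wpDl ?dot_ge0.
(* for |x|^2 <= e / t both terms of Young's inequality are at most e *)
pose t := (sq v + 1) / e.
have t0 : 0 < t by rewrite divr_gt0.
have tv : t^-1 * sq v <= e.
  by rewrite /t invf_div mulrAC ler_pdivrMr// ler_pM2l// lerDl.
have small x : t * sq x <= e -> dot x v <= e.
  by have := young x v t0; lra.
move/cvgrPdist_le: zl => /(_ (e / t) (divr_gt0 e0 t0)); apply: filterS => n.
rewrite sub0r normrN ger0_norm ?dot_ge0// ler_pdivlMr// mulrC => ze.
rewrite -dotBl ler_norml lerNl -dotNl opprB !small// -opprB dotNl.
by rewrite dotC// dotNl opprK.
Qed.

Lemma cauchy_schwarz x y : dot x y ^+ 2 <= sq x * sq y.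
Proof.
have [y0|y0] := ltP 0 (sq y); last first.
  by rewrite (dot_eq0 hdot y0) dotC// !dot0l expr0n mulr0.
have := dot_ge0 hdot (sq y *: x - dot x y *: y).
rewrite sqdotB !sqdotZ dotZl dotZr.
rewrite (_ : _ + _ = sq y * (sq x * sq y - dot x y ^+ 2)); last by ring.
by rewrite pmulr_rge0// subr_ge0.
Qed.

(** The vector sought is the minimiser of the energy |x|^2 - 2 phi x. *)
Lemma riesz (phi : V -> R) (K : R) :
  (forall a x y, phi (a *: x + y) = a * phi x + phi y) ->
  (forall x, phi x ^+ 2 <= K * sq x) ->
  exists c, forall v, phi v = dot c v.
Proof.
move=> philin phiK.
have phi0 : phi 0 = 0 by have := philin 1 0 0; rewrite scaler0 addr0; lra.
have phiZ a x : phi (a *: x) = a * phi x by rewrite -[a *: x]addr0 philin phi0 addr0.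
have phiD x y : phi (x + y) = phi x + phi y.
  by rewrite -[x]scale1r philin mul1r scale1r.
have phiB x y : phi (x - y) = phi x - phi y.
  by rewrite phiD -scaleN1r phiZ mulN1r.
have phi_le e x : 0 < e -> 2 * phi x <= e + e^-1 * (K * sq x).
  move=> e0; have h : e^-1 * phi x ^+ 2 <= e^-1 * (K * sq x).
    by rewrite ler_pM2l ?invr_gt0.
  have : 0 <= e^-1 * (phi x - e) ^+ 2 by rewrite mulr_ge0 ?sqr_ge0// invr_ge0 ltW.
  rewrite (_ : _ * _ = e^-1 * phi x ^+ 2 - 2 * phi x + e); last first.
    by field; rewrite gt_eqF.
  by lra.
pose F x : \bar R := (sq x - 2 * phi x)%:E.
have [c Fc] : argmin F !=set0.
  apply: (@strongly_convex_argmin F (- (`|K| + 1)) (4^-1)) => //.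
  - move=> x; rewrite lee_fin.
    have K0 : 0 < `|K| + 1 by rewrite ltr_wpDl.
    have := phi_le (`|K| + 1) x K0.
    have : (`|K| + 1)^-1 * (K * sq x) <= sq x.
      rewrite mulrC ler_pdivrMr// mulrC ler_wpM2l ?dot_ge0//.
      by rewrite (le_trans (ler_norm K))// lerDl.
    by lra.
  - by exists 0, (sq 0 - 2 * phi 0).
  - move=> x y r; rewrite !lee_fin sqdotZ sqdotD sqdotB phiZ phiD.
    by lra.
  - move=> z l r zl; rewrite /F => Fz; rewrite lee_fin; apply/ler_addgt0Pr => e e0.
    have h : (fun n => r - 2 * (dot (z n) l - dot l l)
        + (e + e^-1 * (K * sq (z n - l)))) @ \oo
        --> r - 2 * (dot l l - dot l l) + (e + e^-1 * (K * 0)).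
      apply: cvgD.
        apply: cvgB; first exact: cvg_cst.
        apply: cvgMr; apply: cvgB; [exact: dot_cvgl|exact: cvg_cst].
      apply: cvgD; first exact: cvg_cst.
      by apply: cvgMr; apply: cvgMr.
    have -> : r + e = r - 2 * (dot l l - dot l l) + (e + e^-1 * (K * 0)) by ring.
    apply: ler_cvg_to (cvg_cst _) h _; apply: nearW => n.
    have := Fz n; rewrite lee_fin; have := phi_le e (z n - l) e0.
    have := dot_ge0 hdot (z n - l); rewrite phiB.
    set P := e^-1 * _; rewrite sqdotB; lra.
exists c => v.
suff le_c w : phi w <= dot c w.
  apply/eqP; rewrite eq_le le_c/=.
  by have := le_c (- v); rewrite -scaleN1r phiZ dotZr; lra.
rewrite -subr_ge0 -(@pmulr_rge0 _ 2)//.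
apply: (@ge0_of_small_quad _ _ (sq w)) => t /andP[t0 t1].
have := Fc (t *: w + c); rewrite lee_fin sqdotD phiD phiZ sqdotZ dotZl (dotC hdot w).
by lra.
Qed.

Lemma ultra_bounded_cvg T (W : set_system T) (f : T -> R) (B : R) :
  UltraFilter W -> (forall n, `|f n| <= B) -> cvg (f @ W).
Proof.
move=> UW fB; have PW : ProperFilter W by exact: ultra_proper.
have [|p [_ cp]] := @segment_compact R (- B) B (f @ W) (fmap_proper_filter _ PW).
  by apply: nearW => n; rewrite /= in_itv/= -ler_norml.
apply/cvg_ex; exists p => A /= pA; rewrite /fmap/=.
have [//|WnA] := in_ultra_setVsetC (f @^-1` A) UW.
by have [q [/= nAq Aq]] := cp (~` A) A WnA pA.
Qed.

(** Along an ultrafilter every bounded real sequence converges, so the weak limit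
    of a bounded sequence exists as a bounded linear functional, and Riesz turns
    it into a vector.  This plays the part of weak sequential compactness. *)
Lemma ultra_weak_limit (W : set_system nat) (z : nat -> V) (B : R) :
  UltraFilter W -> (forall n, sq (z n) <= B) ->
  exists c, forall v, (fun n => dot (z n) v) @ W --> dot c v.
Proof.
move=> UW zB; have PW : ProperFilter W by exact: ultra_proper.
have dotB v n : dot (z n) v ^+ 2 <= B * sq v.
  by rewrite (le_trans (cauchy_schwarz _ _))// ler_wpM2r// dot_ge0.
have cv v : cvg ((fun n => dot (z n) v) @ W).
  apply: (@ultra_bounded_cvg _ _ _ (B * sq v + 1)) => // n.
  have := dotB v n; rewrite -real_normK ?num_real//.
  by have := sqr_ge0 (`|dot (z n) v| - 1); have := sqr_ge0 `|dot (z n) v|; lra.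
pose phi v := lim ((fun n => dot (z n) v) @ W).
have phiP v : (fun n => dot (z n) v) @ W --> phi v by exact: cv.
have [|v|c cP] := @riesz phi B.
- move=> a x y; apply: cvg_lim => //.
  under eq_fun do rewrite dotDr dotZr.
  by apply: cvgD => //; apply: cvgMr.
- apply: (@ler_cvg_to _ W _ _ (fun n => dot (z n) v ^+ 2) (fun=> B * sq v)).
  + by rewrite expr2; under eq_fun do rewrite expr2; apply: cvgM.
  + exact: cvg_cst.
  + by apply: nearW => n.
- by exists c => v; rewrite -cP.
Qed.

Definition nonexpansive (N : V -> V) : Prop :=
  forall x y, sq (N x - N y) <= sq (x - y).

(** Expand |z n - N c|^2 around c on one side and around N (z n) on the other: up to
    terms that tend to 0, nonexpansiveness leaves |c - N c|^2 <= 0. *)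
Lemma demiclosed (W : set_system nat) (N : V -> V) (z : nat -> V) c (B : R) :
  ProperFilter W -> nonexpansive N -> (forall n, sq (z n - c) <= B) ->
  (forall v, (fun n => dot (z n) v) @ W --> dot c v) ->
  (fun n => sq (N (z n) - z n)) @ W --> (0 : R) ->
  N c = c.
Proof.
move=> PW Nn zB zc Nz; apply/eqP; rewrite eq_sym -subr_eq0; apply/eqP.
apply: (dot_eq0 hdot); apply/ler_addgt0Pr => e e0; rewrite add0r.
have B1 : 0 < `|B| + 1 by rewrite ltr_wpDl.
pose t := e / (`|B| + 1).
have t0 : 0 < t by rewrite divr_gt0.
have h : (fun n => (1 + t^-1) * sq (N (z n) - z n) + e
     - 2 * (dot (z n) (c - N c) - dot c (c - N c))) @ W -->
    (1 + t^-1) * 0 + e - 2 * (dot c (c - N c) - dot c (c - N c)).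
  apply: cvgB; first by apply: cvgD; [exact: cvgMr|exact: cvg_cst].
  by apply: cvgMr; apply: cvgB => //; exact: cvg_cst.
have -> : e = (1 + t^-1) * 0 + e - 2 * (dot c (c - N c) - dot c (c - N c)) by ring.
apply: ler_cvg_to (cvg_cst _) h _; apply: nearW => n.
have tB : t * sq (z n - c) <= e.
  rewrite /t mulrAC ler_pdivrMr// ler_pM2l// (le_trans (zB n))//.
  by rewrite (le_trans (ler_norm B))// lerDl.
have := Nn (z n) c; have := young (N (z n) - N c) (z n - N (z n)) t0.
have -> : sq (N (z n) - z n) = sq (z n - N (z n)).
  by rewrite -opprB dotNl dotNr opprK.
have : sq ((z n - c) + (c - N c)) = sq ((N (z n) - N c) + (z n - N (z n))).
  by congr dot; rewrite addrA subrK [RHS]addrC addrA subrK.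
rewrite (sqdotD (z n - c)) (sqdotD (N (z n) - N c)) -(dotBl (z n) c).
move=> h1 h2 h3.
have : t * sq (N (z n) - N c) <= t * sq (z n - c) by rewrite ler_pM2l.
lra.
Qed.

(** Fejer monotonicity bounds the sum of the weighted squared residuals; as the
    residuals decrease and the weights have an infinite sum, the residuals tend to
    0.  Weak cluster points are taken along ultrafilters that contain the
    cofinite sets: they are fixed points by [demiclosed], and they all coincide by
    Opial's argument. *)
Theorem krasnoselskii_mann (N : V -> V) (lambda : nat -> R) (z : nat -> V) p :
  nonexpansive N -> N p = p -> (forall i, 0 <= lambda i <= 1) ->
  (forall A, exists n, A <= \sum_(0 <= i < n) lambda i * (1 - lambda i)) ->
  (forall i, z i.+1 = z i + lambda i *: (N (z i) - z i)) ->
  exists2 c, N c = c & forall v, (fun n => dot (z n) v) @ \oo --> dot c v.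
Proof.
move=> Nn Np lambda01 lambdaoo zS.
pose E n := sq (N (z n) - z n).
have fejer q : N q = q -> forall n,
    sq (z n.+1 - q) <= sq (z n - q) - lambda n * (1 - lambda n) * E n.
  move=> Nq n; have /andP[l0 l1] := lambda01 n.
  have := Nn (z n) q; rewrite Nq /E => h.
  have -> : N (z n) - z n = (N (z n) - q) - (z n - q) by rewrite opprB addrA subrK.
  have -> : z n.+1 - q = (z n - q) + lambda n *: ((N (z n) - q) - (z n - q)).
    by rewrite zS opprB [N _ - _ + _]addrA subrK addrAC.
  move: h; move: (z n - q) (N (z n) - q) => a b h.
  rewrite sqdotD sqdotZ dotZr sqdotB dotBr (dotC hdot b a).
  have : 0 <= lambda n * (sq a - sq b) by rewrite mulr_ge0// subr_ge0.
  lra.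
have lam_ge0 n : 0 <= lambda n * (1 - lambda n).
  by have /andP[? ?] := lambda01 n; rewrite mulr_ge0// subr_ge0.
have E_ge0 n : 0 <= E n by exact: dot_ge0.
have dist_mono q : N q = q ->
    {homo (fun n => sq (z n - q)) : n m / (n <= m)%N >-> m <= n}.
  move=> Nq; apply/nonincreasing_seqP => n.
  by rewrite (le_trans (fejer _ Nq n))// gerBl mulr_ge0.
have dist_cvg q : N q = q -> cvgn (fun n => sq (z n - q)).
  move=> Nq; apply: nonincreasing_is_cvgn; first exact: dist_mono.
  by exists 0 => _ [n _ <-]; exact: dot_ge0.
have E_mono : {homo E : n m / (n <= m)%N >-> m <= n}.
  apply/nonincreasing_seqP => n; have /andP[l0 l1] := lambda01 n.
  rewrite /E; have -> : N (z n.+1) - z n.+1 =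
      (N (z n.+1) - N (z n)) + (1 - lambda n) *: (N (z n) - z n).
    by rewrite scalerBl scale1r {2}zS opprD !addrA subrK.
  have := Nn (z n.+1) (z n).
  have -> : z n.+1 - z n = lambda n *: (N (z n) - z n) by rewrite zS addrC addKr.
  move: (N (z n.+1) - N (z n)) (N (z n) - z n) => a b.
  rewrite sqdotD !sqdotZ dotZr => ab.
  have [l00|lpos] := leP (lambda n) 0.
    have l_0 : lambda n = 0 by apply/eqP; rewrite eq_le l00.
    have a0 : a = 0 by apply: (dot_eq0 hdot); move: ab; rewrite l_0 expr0n mul0r.
    by rewrite a0 l_0 !dot0l; lra.
  have := young a b (ltac:(by rewrite invr_gt0) : 0 < (lambda n)^-1).
  rewrite invrK => y.
  have : (lambda n)^-1 * sq a <= lambda n * sq b.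
    by rewrite mulrC ler_pdivrMr// mulrAC -expr2.
  move: y; set q := _ * sq a => y h.
  have : (1 - lambda n) * (2 * dot a b) <= (1 - lambda n) * (2 * (lambda n * sq b)).
    by rewrite ler_wpM2l ?subr_ge0//; lra.
  lra.
have E_cvg : E @ \oo --> (0 : R).
  apply/cvgrPdist_le => e e0.
  pose D := sq (z 0%N - p).
  have sumE n : \sum_(0 <= i < n) lambda i * (1 - lambda i) * E i <= D - sq (z n - p).
    elim: n => [|n ih]; first by rewrite big_nil subrr.
    by rewrite big_nat_recr//=; have := fejer _ Np n; lra.
  have [n An] := lambdaoo ((D + 1) / e).
  exists n => // m /= nm; rewrite sub0r normrN ger0_norm//.
  rewrite leNgt; apply/negP => eE.
  have : \sum_(0 <= i < n) lambda i * (1 - lambda i) * e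
      <= \sum_(0 <= i < n) lambda i * (1 - lambda i) * E i.
    rewrite !big_nat; apply: ler_sum => i /andP[_ im]; rewrite ler_wpM2l//.
    by rewrite (le_trans (ltW eE))// E_mono// (leq_trans (ltnW im)).
  rewrite -mulr_suml; have := sumE n; have := dot_ge0 hdot (z n - p).
  by move: An; rewrite ler_pdivrMr//; lra.
have weak_lim W : UltraFilter W -> \oo `<=` W ->
    exists2 c, N c = c & forall v, (fun n => dot (z n) v) @ W --> dot c v.
  move=> UW ooW; have PW : ProperFilter W by exact: ultra_proper.
  have zp n : sq (z n - p) <= sq (z 0%N - p) by exact: (dist_mono _ Np).
  have bound q n : sq (z n - q) <= 2 * sq (z 0%N - p) + 2 * sq (p - q).
    have -> : z n - q = (z n - p) + (p - q) by rewrite addrA subrK.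
    rewrite sqdotD; have := young (z n - p) (p - q) ltr01; have := zp n.
    by rewrite invr1; lra.
  have [c cP] : exists c, forall v, (fun n => dot (z n) v) @ W --> dot c v.
    by apply: ultra_weak_limit => n; have := bound 0 n; rewrite subr0; apply.
  exists c => //; have EW : E @ W --> (0 : R) by move=> A /E_cvg; exact: ooW.
  exact: (demiclosed PW Nn (bound c) cP EW).
(* Opial: the difference of the squared distances to two fixed points is
   affine in z n, and it has a limit *)
have opial W W' c c' : ProperFilter W -> ProperFilter W' ->
    \oo `<=` W -> \oo `<=` W' -> N c = c -> N c' = c' ->
    (forall v, (fun n => dot (z n) v) @ W --> dot c v) ->
    (forall v, (fun n => dot (z n) v) @ W' --> dot c' v) -> c = c'.
  move=> PW PW' oW oW' Nc Nc' cP cP'.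
  have [l lP] : exists l : R, (fun n => dot (z n) (c - c')) @ \oo --> l.
    exists (2^-1 * (sq c - sq c' -
      (limn (fun n => sq (z n - c)) - limn (fun n => sq (z n - c'))))).
    rewrite (_ : (fun n => _) =
      (fun n => 2^-1 * (sq c - sq c' - (sq (z n - c) - sq (z n - c'))))).
      apply: cvgMr; apply: cvgB; first exact: cvg_cst.
      by apply: cvgB; exact: dist_cvg.
    by apply/funext => n; rewrite !sqdotB dotBr; field.
  have lc : dot c (c - c') = l.
    by apply: (cvg_unique _ (cP (c - c'))) => //; move=> A /lP; exact: oW.
  have lc' : dot c' (c - c') = l.
    by apply: (cvg_unique _ (cP' (c - c'))) => //; move=> A /lP; exact: oW'.
  apply/eqP; rewrite -subr_eq0; apply/eqP; apply: (dot_eq0 hdot).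
  by rewrite dotBl lc lc' subrr.
have [W [UW oW]] := ultraFilterLemma (_ : ProperFilter \oo).
have [c Nc cP] := weak_lim W UW oW.
exists c => // v; apply/cvgrPdist_lt => e e0; apply: contrapT => ne.
pose A := [set n | ~ `|dot c v - dot (z n) v| < e].
have PA : ProperFilter (within A \oo).
  apply: Build_ProperFilter_ex => P AP; apply: contrapT => nP; apply: ne.
  have : \forall n \near \oo, A n -> P n by exact: AP.
  apply: filterS => n {}AP; apply: contrapT => nA; apply: nP.
  by exists n; apply: AP.
have [W' [UW' AW']] := ultraFilterLemma PA.
have oW' : \oo `<=` W'.
  by move=> P oP; apply: (AW' P); exact: (filterS (fun n Pn _ => Pn) oP).
have [c' Nc' cP'] := weak_lim W' UW' oW'.
have PW : ProperFilter W by exact: ultra_proper.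
have PW' : ProperFilter W' by exact: ultra_proper.
have cc' := opial W W' c c' PW PW' oW oW' Nc Nc' cP cP'.
have /cvgrPdist_lt/(_ e e0) := cP' v.
rewrite -cc' => We.
have [n []] : exists n, A n /\ `|dot c v - dot (z n) v| < e.
  apply: (@filter_ex _ W'); apply: filterI => //.
  by apply: (AW' A); exact: withinT.
by [].
Qed.

End complete_dot.

(** * Hilbert spaces *)

Section hilbert.
Context {R : realType} (H : hilbertType R).

Lemma dot_cvg_inner (z : nat -> H) l : dot_cvg inner z l <-> z @ \oo --> l.
Proof.
split=> zl.
  apply/cvgrPdist_le => e e0; move/cvgrPdist_le: zl => /(_ (e ^+ 2)).
  rewrite exprn_gt0// => /(_ isT); apply: filterS => n.
  rewrite sub0r normrN -sqr_norm_inner normrX normr_id distrC.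
  by rewrite ler_pXn2r ?nnegrE// ltW.
rewrite /dot_cvg; under eq_fun do rewrite -sqr_norm_inner.
rewrite -(mul0r 0) -(normr0 H); under eq_fun do rewrite expr2.
have zl0 : (fun n => z n - l) @ \oo --> (0 : H).
  by rewrite -(subrr l); apply: cvgB => //; exact: cvg_cst.
by apply: cvgM; apply: cvg_norm.
Qed.

Lemma inner_complete : complete_dot (@inner R H).
Proof.
split.
- by move=> x y; have := hermC (@inner R H) x y; rewrite expr0 mul1r.
- by move=> a x y z; rewrite linearPl.
- by move=> x; rewrite -sqr_norm_inner exprn_ge0.
- move=> x; rewrite -sqr_norm_inner => x0; apply/eqP; rewrite -normr_eq0 -sqrf_eq0.
  by rewrite eq_le x0 exprn_ge0.
- move=> z zc; suff : cvg (z @ \oo).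
    by move=> /cvg_ex[l zl]; exists l; apply/dot_cvg_inner.
  apply/cauchy_cvgP/cauchy_exP => e e0.
  have [|N zN] := zc ((e / 2) ^+ 2); first by rewrite exprn_gt0// divr_gt0.
  exists (z N); exists N => // n /= Nn; rewrite -ball_normE/=.
  have := zN N n (leqnn N) Nn; rewrite -sqr_norm_inner.
  have e2 : 0 <= e / 2 by rewrite divr_ge0// ltW.
  rewrite ler_pXn2r ?nnegrE// => h.
  by rewrite (le_lt_trans h)//; lra.
Qed.

Lemma innerC (x y : H) : '[x, y] = '[y, x].
Proof. exact: dotC inner_complete _ _. Qed.

Lemma innerDl (x y z : H) : '[x + y, z] = '[x, z] + '[y, z].
Proof. exact: dotDl inner_complete _ _ _. Qed.

Lemma innerDr (x y z : H) : '[z, x + y] = '[z, x] + '[z, y].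
Proof. exact: dotDr inner_complete _ _ _. Qed.

Lemma innerBl (x y z : H) : '[x - y, z] = '[x, z] - '[y, z].
Proof. exact: dotBl inner_complete _ _ _. Qed.

Lemma innerBr (x y z : H) : '[z, x - y] = '[z, x] - '[z, y].
Proof. exact: dotBr inner_complete _ _ _. Qed.

Lemma innerNl (x z : H) : '[- x, z] = - '[x, z].
Proof. exact: dotNl inner_complete _ _. Qed.

Lemma innerNr (x z : H) : '[z, - x] = - '[z, x].
Proof. exact: dotNr inner_complete _ _. Qed.

Lemma innerZl a (x z : H) : '[a *: x, z] = a * '[x, z].
Proof. exact: dotZl inner_complete _ _ _. Qed.

Lemma innerZr a (x z : H) : '[z, a *: x] = a * '[z, x].
Proof. exact: dotZr inner_complete _ _ _. Qed.

Lemma inner_ge0 (x : H) : 0 <= '[x, x].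
Proof. exact: dot_ge0 inner_complete _. Qed.

Lemma inner_suml I (r : seq I) (P : pred I) (F : I -> H) z :
  '[\sum_(i <- r | P i) F i, z] = \sum_(i <- r | P i) '[F i, z].
Proof.
apply: (big_morph (fun x : H => '[x, z])); last exact: dot0l inner_complete _.
by move=> x y; exact: innerDl.
Qed.

Lemma inner_le_norm (x y : H) : '[x, y] <= `|x| * `|y|.
Proof.
rewrite (le_trans (ler_norm _))// -ler_sqr ?nnegrE ?mulr_ge0//.
rewrite real_normK ?num_real// exprMn !sqr_norm_inner.
exact: cauchy_schwarz inner_complete _ _.
Qed.

(** Vectors of a Hilbert space are compared through their inner products with all
    vectors, which turns vector identities into ring identities. *)
Lemma inner_eqr (x y : H) : (forall z, '[z, x] = '[z, y]) -> x = y.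
Proof.
move=> xy; apply/eqP; rewrite -subr_eq0; apply/eqP.
by apply: (dot_eq0 inner_complete); rewrite innerBr xy subrr.
Qed.

End hilbert.

Section adjoint_gradient.
Context {R : realType}.
Implicit Types H G : hilbertType R.

Lemma bounded_linear_lipschitz H G (L : {linear H -> G}) :
  bounded_fun_norm L -> exists2 K, 0 < K & forall x, `|L x| <= K * `|x|.
Proof. by move=> /bounded_landau/linear_continuous/linear_lipschitz. Qed.

Lemma adjointP H G (L : {linear H -> G}) : bounded_fun_norm L ->
  forall x u, '[L x, u] = '[x, adjoint L u].
Proof.
move=> /bounded_linear_lipschitz[K K0 LK] x u.
have [||c cP] := @riesz _ _ _ (inner_complete H) (fun x => '[L x, u]) ((K * `|u|) ^+ 2).
- by move=> a y z; rewrite linearP innerDl innerZl.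
- move=> y; rewrite -sqr_norm_inner -exprMn.
  have := cauchy_schwarz (inner_complete G) (L y) u.
  rewrite -!sqr_norm_inner -exprMn => /le_trans; apply.
  rewrite ler_pXn2r ?nnegrE ?mulr_ge0 ?(ltW K0)//.
  by rewrite [leRHS]mulrAC ler_wpM2r.
suff /(xgetPex 0)/(_ x) : [set z | forall x, '[L x, u] = '[x, z]] !=set0 by [].
by exists c => y; rewrite cP innerC.
Qed.

Lemma gradientP H (h : H -> R^o) x : differentiable h x ->
  forall z, 'd h x z = '[gradient h x, z].
Proof.
move=> dh z.
have [K K0 dK] := linear_lipschitz (diff_continuous dh).
have [||c cP] := @riesz _ _ _ (inner_complete H) ('d h x : H -> R) (K ^+ 2).
- by move=> a y w; rewrite linearP.
- move=> y; rewrite -sqr_norm_inner -exprMn -real_normK ?num_real//.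
  by rewrite ler_pXn2r ?nnegrE ?mulr_ge0 ?(ltW K0)//; exact: dK.
suff /(xgetPex 0)/(_ z) : [set v | forall z, 'd h x z = '[v, z]] !=set0 by [].
by exists c.
Qed.

Section linear_adjoint.
Variables (H G : hilbertType R) (L : {linear H -> G}).
Hypothesis hL : bounded_fun_norm L.

Lemma adjointD u v : adjoint L (u + v) = adjoint L u + adjoint L v.
Proof. by apply: inner_eqr => z; rewrite innerDr -!adjointP// innerDr. Qed.

Lemma adjointZ a u : adjoint L (a *: u) = a *: adjoint L u.
Proof. by apply: inner_eqr => z; rewrite innerZr -!adjointP// innerZr. Qed.

Lemma adjoint_lipschitz : exists2 K, 0 < K & forall u, `|adjoint L u| <= K * `|u|.
Proof.
have [K K0 LK] := bounded_linear_lipschitz hL; exists K => // u.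
have [->|z0] := eqVneq (adjoint L u) 0; first by rewrite normr0 mulr_ge0// ltW.
rewrite -(@ler_pM2l _ `|adjoint L u|) ?normr_gt0// -expr2 sqr_norm_inner -adjointP//.
rewrite (le_trans (inner_le_norm _ _))// mulrCA mulrA ler_wpM2r//.
Qed.

End linear_adjoint.
End adjoint_gradient.

Section lipschitz_cocoercive.
Context {R : realType} {H : hilbertType R}.
Variables (f : H -> R) (grad : H -> H) (beta : R).
Hypothesis tangent_le : forall x y, f x + '[y - x, grad x] <= f y.
Hypothesis grad_lip : forall x y, `|grad x - grad y| <= beta * `|x - y|.

(** Euler steps of length [t] along [d]: each step costs at most the slope at
    its far end, and these slopes grow by at most [beta] times the distance
    travelled. *)
Lemma euler_descent x d t (n : nat) : 0 <= t ->
  f (x + (n%:R * t) *: d) <= f x + n%:R * t * '[d, grad x]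
    + beta * `|d| ^+ 2 * t ^+ 2 * (n%:R * (n%:R + 1) / 2).
Proof.
move=> t0; elim: n => [|n ih]; first by rewrite !mul0r scale0r mulr0 !addr0.
set y := x + (n.+1%:R * t) *: d.
have := tangent_le y (x + (n%:R * t) *: d).
have -> : x + (n%:R * t) *: d - y = - t *: d.
  by rewrite /y opprD addrACA subrr add0r -scalerBl -natr1; congr (_ *: _); ring.
rewrite innerZl => slope.
have : '[d, grad y - grad x] <= beta * (n.+1%:R * t) * `|d| ^+ 2.
  rewrite (le_trans (inner_le_norm _ _))//.
  rewrite (_ : _ * _ * _ = `|d| * (beta * (n.+1%:R * t * `|d|))); last by ring.
  rewrite ler_wpM2l// (le_trans (grad_lip _ _))// /y addrAC subrr add0r normrZ.
  by rewrite ger0_norm ?mulr_ge0.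
rewrite innerBr => /(ler_wpM2l t0) step.
move: slope step ih; rewrite -natr1.
set p := f _; set q := f _; set D := '[d, grad x]; set Dy := '[d, grad y].
by lra.
Qed.

(** The limit of [euler_descent] for n + 1 steps of length 1 / (n + 1). *)
Lemma descent x d : f (x + d) <= f x + '[d, grad x] + beta / 2 * `|d| ^+ 2.
Proof.
apply/ler_addgt0Pr => e e0.
have [n ne] : exists n : nat, (beta * `|d| ^+ 2) / e < n.+1%:R.
  exists (Num.truncn ((beta * `|d| ^+ 2) / e)); exact: truncnS_gt.
have n0 : 0 < n.+1%:R :> R by [].
have := euler_descent x d n.+1 (ltac:(by rewrite invr_ge0) : 0 <= n.+1%:R^-1).
rewrite divff ?gt_eqF// scale1r mul1r => /le_trans; apply.
rewrite -[leRHS]addrA lerD2l.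
rewrite ltr_pdivrMr// in ne.
rewrite (_ : _ * _ =
  beta / 2 * `|d| ^+ 2 + (beta * `|d| ^+ 2) / (n.+1%:R) / 2); last first.
  by field; rewrite gt_eqF.
rewrite lerD2l ler_pdivrMr// ler_pdivrMr//.
rewrite (le_trans (ltW ne))// -mulrA mulrC ler_wpM2l ?(ltW e0)//; lra.
Qed.

(** Baillon-Haddad: compare the tangent at [x] with the descent bound from
    [y], at the point where a gradient step from [y] for the tilted function
    f - <., grad x> ends. *)
Lemma lipschitz_cocoercive x y : 0 < beta ->
  `|grad x - grad y| ^+ 2 <= beta * '[grad x - grad y, x - y].
Proof.
move=> b0.
have half u v : f u + '[v - u, grad u] + (beta^-1 / 2) * `|grad u - grad v| ^+ 2 <= f v.
  have [D DE] : exists D, D = grad v - grad u by exists (grad v - grad u).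
  have -> : `|grad u - grad v| ^+ 2 = '[D, D] by rewrite distrC -DE sqr_norm_inner.
  have := tangent_le u (v - beta^-1 *: D).
  have := descent v (- (beta^-1 *: D)).
  have -> : `|- (beta^-1 *: D)| ^+ 2 = beta^-1 ^+ 2 * '[D, D].
    by rewrite sqr_norm_inner innerNl innerNr opprK innerZl innerZr mulrA.
  rewrite (_ : beta / 2 * _ = beta^-1 / 2 * '[D, D]); last first.
    by field; rewrite gt_eqF.
  rewrite addrAC !innerBl innerNl !innerZl => h1 h2.
  have DD : '[D, D] = '[D, grad v] - '[D, grad u] by rewrite -innerBr -DE.
  by move: h1 h2; rewrite DD; lra.
have h1 := half x y; have h2 := half y x.
rewrite -(@ler_pM2l _ beta^-1) ?invr_gt0// [leRHS]mulrA mulVf ?gt_eqF// mul1r.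
move: h1 h2; rewrite (distrC (grad y)) !innerBr !innerBl.
rewrite (innerC (grad x) x) (innerC (grad x) y) (innerC (grad y) x).
rewrite (innerC (grad y) y); lra.
Qed.

End lipschitz_cocoercive.

Section smooth_convex.
Context {R : realType} {H : hilbertType R} (h : H -> R^o).
Hypothesis h_convex : convex_function [set: H] h.
Hypothesis h_diff : forall x, differentiable h x.

(** By convexity the difference quotients from x towards y stay below h y - h x;
    let the step tend to 0 from the right. *)
Lemma gradient_ineq x y : h x + '[y - x, gradient h x] <= h y.
Proof.
rewrite innerC -gradientP// -deriveE// -lerBrDl.
have /cvg_dnbhs_at_right dh := diff_derivable (v := y - x) (h_diff x).
have PF : ProperFilter (0 : R)^'+ by exact: at_right_proper_filter.
apply: (@ler_cvg_to _ _ PF R _ (fun=> h y - h x) _ _ dh); first exact: cvg_cst.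
near=> t.
have t0 : 0 < t by near: t; exact: nbhs_right_gt.
have t1 : t <= 1 by near: t; exact: nbhs_right_le.
rewrite /= -[X in X <= _]/(t^-1 * _) mulrC ler_pdivrMr//.
have /= := h_convex (Itv01 (ltW t0) t1) (in_setT y) (in_setT x).
rewrite !convRE/= => hc.
have -> : t *: (y - x) + x = t *: y + (1 - t) *: x.
  by rewrite scalerBr scalerBl scale1r -addrA [- _ + _]addrC.
rewrite (le_trans (lerB hc (lexx _)))// /unstable.onem; lra.
Unshelve. all: by end_near. Qed.

Lemma gradient_cocoercive (beta : R) x y : 0 < beta ->
  (forall x y, `|gradient h x - gradient h y| <= beta * `|x - y|) ->
  `|gradient h x - gradient h y| ^+ 2 <=
    beta * '[gradient h x - gradient h y, x - y].
Proof.
by move=> b0 lip; exact: (lipschitz_cocoercive (f := h) gradient_ineq lip).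
Qed.

End smooth_convex.

(** * Proximal points, subdifferentials and conjugates *)

Section convex_calculus.
Context {R : realType} {H : hilbertType R}.
Implicit Types (f : H -> \bar R) (x y p v w : H).

Lemma subdiff_fin f p v : proper f -> subdiff f p v -> f p \is a fin_num.
Proof.
move=> [fNoo [x fx]] /(_ x) fp; rewrite fin_numE fNoo/=.
by apply/negP => /eqP fpoo; move: fp; rewrite fpoo addye// leye_eq (negPf fx).
Qed.

Lemma subdiff_monotone f p q v w : proper f -> subdiff f p v -> subdiff f q w ->
  0 <= '[p - q, v - w].
Proof.
move=> fpr fp fq; have := fp q; have := fq p.
rewrite -(fineK (subdiff_fin fpr fp)) -(fineK (subdiff_fin fpr fq)).
rewrite -!EFinD !lee_fin !innerBr !innerBl; lra.
Qed.

Lemma sqnormB_mid x y w : `|2^-1 *: (x + y) - w| ^+ 2 =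
  2^-1 * `|x - w| ^+ 2 + 2^-1 * `|y - w| ^+ 2 - 4^-1 * `|x - y| ^+ 2.
Proof.
rewrite !sqr_norm_inner !(innerBl, innerBr, innerZl, innerZr, innerDl, innerDr).
by rewrite (innerC y x) (innerC w x) (innerC w y); field.
Qed.

(** If w - p is a subgradient at p, the proximal objective at y exceeds its value at
    p by at least |y - p|^2 / 2, so that p is its only minimiser. *)
Lemma prox_of_subdiff f w p : proper f -> subdiff f p (w - p) -> prox f w = p.
Proof.
move=> fpr fp; have := fineK (subdiff_fin fpr fp); set r := fine _ => rE.
have three y : '[y - p, w - p] + 2^-1 * `|y - w| ^+ 2 =
    2^-1 * `|p - w| ^+ 2 + 2^-1 * `|y - p| ^+ 2.
  rewrite !sqr_norm_inner !(innerBl, innerBr).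
  by rewrite (innerC p w) (innerC w y) (innerC p y); field.
have lb y : (r%:E + (2^-1 * `|p - w| ^+ 2 + 2^-1 * `|y - p| ^+ 2)%:E <=
    f y + (2^-1 * `|y - w| ^+ 2)%:E)%E.
  by rewrite -three EFinD addeA leeD2r// rE; exact: fp.
have : argmin (fun y => f y + (2^-1 * `|y - w| ^+ 2)%:E)%E !=set0.
  exists p => y; apply: le_trans (lb y); rewrite -rE leeD2l// lee_fin lerDl.
  by rewrite mulr_ge0// exprn_ge0.
move=> /(xgetPex 0) /(_ p) qp; apply/eqP; rewrite -subr_eq0 -normr_eq0 -sqrf_eq0.
have := le_trans (lb (prox f w)) qp; rewrite -rE -!EFinD lee_fin -/(prox f w).
have := exprn_ge0 2 (normr_ge0 (prox f w - p)); rewrite eq_le.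
by lra.
Qed.

(** An affine minorant is what bounds the proximal objective from below. *)
Definition affinely_minorized f : Prop :=
  exists v k, forall y, (('[y, v] + k)%:E <= f y)%E.

Lemma subdiff_minorized f p v : proper f -> subdiff f p v -> affinely_minorized f.
Proof.
move=> fpr fp; exists v, (fine (f p) - '[p, v]) => y; apply: le_trans (fp y).
by rewrite -(fineK (subdiff_fin fpr fp)) -EFinD lee_fin innerBl; lra.
Qed.

Lemma prox_argmin f w : Gamma0 f -> affinely_minorized f ->
  argmin (fun y => f y + (2^-1 * `|y - w| ^+ 2)%:E)%E (prox f w).
Proof.
move=> [fconv [fNoo [x0 fx0]] flsc] [v [k fmin]].
suff /(xgetPex 0) : argmin (fun y => f y + (2^-1 * `|y - w| ^+ 2)%:E)%E !=set0 by [].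
apply: (@strongly_convex_argmin _ _ _ (inner_complete H) _
  ('[w, v] + k - 2^-1 * `|v| ^+ 2) (8^-1)) => //.
- move=> y; apply: le_trans (leeD (fmin y) (lexx _)).
  rewrite -EFinD lee_fin.
  have := young (inner_complete H) (w - y) v ltr01; rewrite invr1 !mul1r.
  rewrite -!sqr_norm_inner innerBl (distrC y w); lra.
- exists x0, (fine (f x0) + 2^-1 * `|x0 - w| ^+ 2).
  by rewrite EFinD fineK// fin_numE fNoo fx0.
- have fin y r : (f y + (2^-1 * `|y - w| ^+ 2)%:E <= r%:E)%E ->
      exists2 a : R, f y = a%:E & a + 2^-1 * `|y - w| ^+ 2 <= r.
    have := fNoo y; case: (f y) => // a _; first by exists a.
  move=> x y r /fin[a fx ar] /fin[b fy br].
  have := fconv x y (2^-1); rewrite fx fy -!EFinM -EFinD.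
  have h01 : 0 < (2^-1 : R) < 1.
    by apply/andP; split; lra.
  move=> /(_ h01).
  have -> : 2^-1 *: x + (1 - 2^-1) *: y = 2^-1 *: (x + y).
    by rewrite scalerDr; congr (_ + _ *: _); field.
  move=> /(leeD2r (2^-1 * `|2^-1 *: (x + y) - w| ^+ 2)%:E) /le_trans; apply.
  by rewrite -EFinD lee_fin sqnormB_mid -sqr_norm_inner; lra.
- move=> z l r /dot_cvg_inner zl zr; rewrite leNgt; apply/negP => rl.
  have [a ra al] : exists2 a : R, r < a + 2^-1 * `|l - w| ^+ 2 & (a%:E < f l)%E.
    move: rl; have := fNoo l; case: (f l) => // [b|] _ rl.
      exists ((b + (r - 2^-1 * `|l - w| ^+ 2)) / 2); rewrite ?lte_fin.
        by move: rl; rewrite -EFinD lte_fin; lra.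
      by move: rl; rewrite -EFinD lte_fin; lra.
    by exists (r - 2^-1 * `|l - w| ^+ 2 + 1); [lra|rewrite ltry].
  have [V lV Va] := flsc l a al.
  have h : (fun n => a + 2^-1 * `|z n - w| ^+ 2) @ \oo --> a + 2^-1 * `|l - w| ^+ 2.
    apply: cvgD; first exact: cvg_cst.
    apply: cvgMr; rewrite expr2; under eq_fun do rewrite expr2.
    have zw : (fun n => `|z n - w|) @ \oo --> `|l - w|.
      by apply: cvg_norm; apply: cvgB => //; exact: cvg_cst.
    exact: cvgM.
  have [n [Vn]] : exists n, V (z n) /\ r < a + 2^-1 * `|z n - w| ^+ 2.
    apply: (@filter_ex _ \oo); apply: filterI; first exact: (zl _ lV).
    exact: (cvgr_gt _ h).
  have := zr n; have := Va _ Vn; case: (f (z n)) => // b.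
  by rewrite lte_fin -EFinD lee_fin; lra.
Qed.

(** First-order optimality: compare the minimiser p with p + t (y - p) and let t
    tend to 0. *)
Lemma subdiff_prox f w : Gamma0 f -> affinely_minorized f ->
  subdiff f (prox f w) (w - prox f w).
Proof.
move=> fG fmin; have := prox_argmin w fG fmin; move: (prox f w) => p pmin.
have [fconv [fNoo [x0 fx0]] _] := fG.
have fp : f p \is a fin_num.
  rewrite fin_numE fNoo/=; apply/negP => /eqP fpoo.
  have := pmin x0; rewrite fpoo addye// leye_eq.
  by have := fNoo x0; case: (f x0) fx0.
move=> y; have [fyoo|fyNoo] := eqVneq (f y) +oo%E; first by rewrite fyoo leey.
have fy : f y \is a fin_num by rewrite fin_numE fNoo.
rewrite -(fineK fp) -(fineK fy) -EFinD lee_fin -subr_ge0.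
apply: (@ge0_of_small_quad _ _ (2^-1 * `|y - p| ^+ 2)) => t t01.
have := fconv y p t t01; have := pmin (t *: y + (1 - t) *: p).
have -> : t *: y + (1 - t) *: p = p + t *: (y - p).
  by rewrite scalerBr scalerBl scale1r addrCA addrC -addrA [- _ + _]addrC addrCA.
rewrite -(fineK fp) -(fineK fy) => h1.
move=> /(leeD2r (2^-1 * `|p + t *: (y - p) - w| ^+ 2)%:E) /(le_trans h1).
rewrite -!EFinM -!EFinD lee_fin.
have -> : p + t *: (y - p) - w = t *: (y - p) - (w - p) by rewrite opprB addrAC addrC.
rewrite (distrC p w) !sqr_norm_inner.
move: (y - p) (w - p) => d e.
by rewrite innerBl !innerBr !innerZl !innerZr (innerC e d); lra.
Qed.

Lemma subdiff_scale f (s : R) p v : 0 < s ->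
  subdiff (fun y => s%:E * f y)%E p v <-> subdiff f p (s^-1 *: v).
Proof.
move=> s0; have E y : (s%:E * f p + '[y - p, v]%:E <= s%:E * f y)%E =
    (f p + '[y - p, s^-1 *: v]%:E <= f y)%E.
  rewrite -[RHS](@lee_pmul2l _ s%:E) ?lte_fin// muleDr//; last first.
    by rewrite fin_num_adde_defl.
  by rewrite -EFinM innerZr mulrA divff ?gt_eqF// mul1r.
by split=> h y; [rewrite -E|rewrite E]; exact: h.
Qed.

Lemma affinely_minorized_scale f (s : R) : 0 < s -> affinely_minorized f ->
  affinely_minorized (fun y => s%:E * f y)%E.
Proof.
move=> s0 [v [k fmin]]; exists (s *: v), (s * k) => y.
have -> : '[y, s *: v] + s * k = s * ('[y, v] + k) by rewrite innerZr mulrDr.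
by rewrite EFinM lee_pmul2l.
Qed.

Lemma Gamma0_scale f (s : R) : 0 < s -> Gamma0 f -> Gamma0 (fun y => s%:E * f y)%E.
Proof.
move=> s0 [fconv [fNoo [x0 fx0]] flsc]; split; last 2 first.
- split=> [x|]; last exists x0.
    by have := fNoo x; case: (f x) => [a| |]; rewrite ?gt0_muley ?lte_fin.
  by have := fx0; case: (f x0) => [a| |] => //; rewrite gt0_muleNy ?lte_fin.
- move=> x a; rewrite -lte_pdivrMl// -EFinM => /flsc[V xV Va].
  by exists V => // y /Va; rewrite EFinM lte_pdivrMl.
- move=> x y t t01; have /andP[t0 t1] := t01.
  rewrite !muleA -!EFinM ![_ * s]mulrC !EFinM -!muleA.
  rewrite -muleDr//; first by rewrite lee_pmul2l//; exact: fconv.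
  have := fNoo x; have := fNoo y; rewrite /adde_def.
  have t1' : 0 < 1 - t by rewrite subr_gt0.
  by case: (f x) => [a| |]; case: (f y) => [b| |] => //;
    rewrite ?gt0_muley ?lte_fin.
Qed.

Lemma conjugate_ge f x y : ('[x, y]%:E - f x <= conjugate f y)%E.
Proof. by apply: ereal_sup_ubound; exists x. Qed.

(** Equality in the Fenchel-Young inequality. *)
Lemma conjugate_subdiff f x v : proper f -> subdiff f x v ->
  conjugate f v = ('[x, v] - fine (f x))%:E.
Proof.
move=> fpr fx; have fxr := fineK (subdiff_fin fpr fx).
apply/eqP; rewrite eq_le; apply/andP; split; last first.
  by rewrite EFinB fxr; exact: conjugate_ge.
apply: ge_ereal_sup => _ [y _ <-].
have := fx y; rewrite -fxr; have := fpr.1 y; case: (f y) => [a| |] // _.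
  by rewrite -EFinD !lee_fin innerBl; lra.
by rewrite addeNy leNye.
Qed.

Lemma subdiff_conjugate f x v : proper f -> subdiff f x v ->
  subdiff (conjugate f) v x.
Proof.
move=> fpr fx y; apply: le_trans (conjugate_ge f x y).
rewrite (conjugate_subdiff fpr fx) -(fineK (subdiff_fin fpr fx)) -EFinB -EFinD lee_fin.
by rewrite innerBl (innerC y) (innerC v); lra.
Qed.

(** The conjugate is a supremum of continuous affine functions, and the subgradient
    shows that it is finite somewhere. *)
Lemma Gamma0_conjugate f x v : proper f -> subdiff f x v -> Gamma0 (conjugate f).
Proof.
move=> fpr fx; split; last 2 first.
- split; last by exists v; rewrite (conjugate_subdiff fpr fx).
  move=> y; have := conjugate_ge f x y; rewrite -(fineK (subdiff_fin fpr fx)) -EFinB.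
  by case: (conjugate f y).
- move=> y a /ereal_sup_gt[_ [z _ <-]].
  have := fpr.1 z; case fz: (f z) => [b| |] // _; rewrite -EFinB lte_fin => ab.
  have z0 : 0 < `|z| + 1 by rewrite ltr_wpDl.
  pose e := ('[z, y] - b - a) / (`|z| + 1).
  have e0 : 0 < e by rewrite divr_gt0// subr_gt0.
  exists (ball y e); first exact: nbhsx_ballx.
  move=> y' yy'; apply: lt_le_trans (conjugate_ge f z y'); rewrite fz -EFinB lte_fin.
  have := inner_le_norm z (y - y'); rewrite innerBr => le1.
  have : `|z| * `|y - y'| < '[z, y] - b - a.
    move: yy'; rewrite -ball_normE/= /e ltr_pdivlMr// => yy'.
    by rewrite mulrC (le_lt_trans _ yy')// ler_wpM2l// lerDl.
  by lra.
- move=> y z t /andP[t0 t1]; apply: ge_ereal_sup => _ [w _ <-].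
  have t1' : 0 < 1 - t by rewrite subr_gt0.
  have := fpr.1 w; case fw: (f w) => [b| |] // _; last by rewrite addeNy leNye.
  have -> : ('[w, t *: y + (1 - t) *: z]%:E - b%:E =
     t%:E * ('[w, y]%:E - f w) + (1 - t)%:E * ('[w, z]%:E - f w))%E.
    by rewrite fw -!EFinB -!EFinM -EFinD innerDr !innerZr; congr (_%:E); ring.
  by apply: leeD; rewrite lee_pmul2l//; exact: conjugate_ge.
Qed.

(** The part of the Fenchel-Moreau theorem that primal optimality calls for, by
    way of Moreau's decomposition: the proximal point q of f at x + u satisfies
    q \in subdiff f^* (x + u - q), and monotonicity against the pair (u, x) gives
    0 <= - |q - x|^2. *)
Lemma subdiff_conjugateK f p v x u : Gamma0 f -> subdiff f p v ->
  subdiff (conjugate f) u x -> subdiff f x u.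
Proof.
move=> fG fp fux; have [_ fpr _] := fG.
have [_ cpr _] := Gamma0_conjugate fpr fp.
have := subdiff_prox (x + u) fG (subdiff_minorized fpr fp).
move: (prox f (x + u)) => q fq.
have := subdiff_monotone cpr (subdiff_conjugate fpr fq) fux.
have -> : x + u - q - u = - (q - x) by rewrite opprB addrAC addrK.
rewrite innerNl oppr_ge0 => /(dot_eq0 (inner_complete H))/eqP.
rewrite subr_eq0 => /eqP qx.
by move: fq; rewrite qx [x + u]addrC addrK.
Qed.

End convex_calculus.

(** * Auxiliary facts on modules, series and operator norms *)

Lemma subrBB (V : zmodType) (a b c d : V) : (a - b) - (c - d) = (a - c) - (b - d).
Proof. by rewrite !opprB addrACA [RHS]addrACA [- c - b]addrC. Qed.

Lemma subr_residual (V : zmodType) (a b c c' d d' : V) :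
  a - b - ((a - c - d) - (b - c' - d')) = (c - c') + (d - d').
Proof.
rewrite -(addrA a (- c)) -(addrA b (- c')) -!(opprD _ d) -(opprD _ d').
by rewrite (subrBB a (c + d)) subKr opprD addrACA.
Qed.

Lemma subr_exchange (V : zmodType) (a b d d' f f' : V) :
  (a - d) - (b - d') = (a - f) - (b - f') - ((d - d') - (f - f')).
Proof.
by rewrite (subrBB a d) (subrBB a f) (subrBB (a - b) (f - f')) subrr subr0.
Qed.

Lemma nneseries_pinfty_unbounded {R : realType} (f : nat -> R) :
  (forall i, 0 <= f i) -> (\sum_(0 <= i <oo) (f i)%:E = +oo)%E ->
  forall A, exists n, A <= \sum_(0 <= i < n) f i.
Proof.
move=> f0 foo A; apply: contrapT => /forallNP fA.
suff : (\sum_(0 <= i <oo) (f i)%:E <= A%:E)%E by rewrite foo leye_eq.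
apply: lime_le.
  by apply: is_cvg_nneseries => n _ _; rewrite lee_fin.
by apply: nearW => n; rewrite sumEFin lee_fin ltW// ltNge; apply/negP/fA.
Qed.

Lemma cvg_sumr {R : realType} (I : Type) (r : seq I) (F : I -> nat -> R) (l : I -> R) :
  (forall i, F i @ \oo --> l i) ->
  (fun n => \sum_(i <- r) F i n) @ \oo --> \sum_(i <- r) l i.
Proof.
move=> Fl; elim: r => [|i r ih].
  by rewrite big_nil; under eq_fun do rewrite big_nil; exact: cvg_cst.
by rewrite big_cons; under eq_fun do rewrite big_cons; exact: cvgD.
Qed.

Lemma opnorm_ge {R : realType} (V W : normedModType R) (T : V -> W) (K : R) :
  (forall a x, T (a *: x) = a *: T x) -> (forall x, `|T x| <= K * `|x|) ->
  forall x, `|T x| <= opnorm T * `|x|.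
Proof.
move=> TZ TK x.
have [->|x0] := eqVneq x 0.
  by rewrite -(scale0r (0 : V)) TZ !scale0r !normr0 mulr0.
have nx : 0 < `|x| by rewrite normr_gt0.
rewrite -ler_pdivrMr// mulrC -[X in X * _]ger0_norm ?invr_ge0// -normrZ -TZ.
apply: ub_le_sup.
  exists `|K| => _ [y /= y1 <-].
  rewrite (le_trans (TK y))// (le_trans (ler_wpM2r _ (ler_norm K)))//.
  by rewrite ler_piMr.
exists (`|x|^-1 *: x) => //=.
by rewrite normrZ ger0_norm ?invr_ge0// mulVf ?gt_eqF.
Qed.

Lemma opnorm_ge0 {R : realType} (V W : normedModType R) (T : V -> W) : 0 <= opnorm T.
Proof.
rewrite /opnorm; set E := [set _ | _ in _].
have [Esup|/sup_out ->//] := pselect (has_sup E).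
have E0 : E `|T 0| by exists 0 => //=; rewrite normr0.
exact: le_trans (normr_ge0 _) (sup_upper_bound Esup E0).
Qed.

(** * The direct sum of a finite family of Hilbert spaces *)

(** An alias of the dependent function type, to carry the pointwise module
    structure. *)
Definition dirsum (R : realType) (M : nat) (U : 'I_M -> hilbertType R) : Type :=
  forall m, U m.

Section dirsum.
Context {R : realType} {M : nat} (U : 'I_M -> hilbertType R).
Implicit Types u v w : dirsum U.

HB.instance Definition _ := gen_eqMixin (dirsum U).
HB.instance Definition _ := gen_choiceMixin (dirsum U).

Let add u v : dirsum U := fun m => u m + v m.
Let opp u : dirsum U := fun m => - u m.
Let zero : dirsum U := fun=> 0.
Let scale (a : R) u : dirsum U := fun m => a *: u m.

Let addA : associative add.
Proof. by move=> u v w; apply: functional_extensionality_dep => m; exact: addrA. Qed.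
Let addC : commutative add.
Proof. by move=> u v; apply: functional_extensionality_dep => m; exact: addrC. Qed.
Let add0 : left_id zero add.
Proof. by move=> u; apply: functional_extensionality_dep => m; exact: add0r. Qed.
Let addN : left_inverse zero opp add.
Proof. by move=> u; apply: functional_extensionality_dep => m; exact: addNr. Qed.

HB.instance Definition _ := GRing.isZmodule.Build (dirsum U) addA addC add0 addN.

Let scaleA a b u : scale a (scale b u) = scale (a * b) u.
Proof. by apply: functional_extensionality_dep => m; exact: scalerA. Qed.
Let scale1 : left_id 1 scale.
Proof. by move=> u; apply: functional_extensionality_dep => m; exact: scale1r. Qed.
Let scaleDr : right_distributive scale +%R.
Proof. by move=> a u v; apply: functional_extensionality_dep => m; exact: scalerDr. Qed.
Let scaleDl u : {morph scale^~ u : a b / a + b}.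
Proof. by move=> a b; apply: functional_extensionality_dep => m; exact: scalerDl. Qed.

HB.instance Definition _ :=
  GRing.Zmodule_isLmodule.Build R (dirsum U) scaleA scale1 scaleDr scaleDl.

Lemma dirsumDE u v m : (u + v) m = u m + v m. Proof. by []. Qed.
Lemma dirsumZE a u m : (a *: u) m = a *: u m. Proof. by []. Qed.

End dirsum.

(** * The preconditioned forward-backward step *)

Section primal_dual.
Context {R : realType} {M : nat} {X : hilbertType R} {U : 'I_M -> hilbertType R}.
Variable (L : forall m, {linear X -> U m}).
Hypothesis hL : forall m, bounded_fun_norm (L m).
Variables (tau : R) (sigma : 'I_M -> R).
Hypotheses (tau_gt0 : 0 < tau) (sigma_gt0 : forall m, 0 < sigma m).
Hypothesis step_size : tau * opnorm (fun x : X =>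
     \sum_(m < M) sigma m *: adjoint (L m) (L m x)) < 1.

Implicit Types (u v : dirsum U) (z : X * dirsum U).

Definition Lstar (u : dirsum U) : X := \sum_(m < M) adjoint (L m) (u m).

Lemma LstarP a u v : Lstar (a *: u + v) = a *: Lstar u + Lstar v.
Proof.
rewrite /Lstar scaler_sumr -big_split; apply: eq_bigr => m _ /=.
by rewrite dirsumDE dirsumZE adjointD// adjointZ.
Qed.

Lemma LstarB u v : Lstar (u - v) = Lstar u - Lstar v.
Proof. by rewrite addrC -scaleN1r LstarP scaleN1r addrC. Qed.

Lemma inner_Lstar x u : '[x, Lstar u] = \sum_(m < M) '[L m x, u m].
Proof.
rewrite innerC /Lstar inner_suml; apply: eq_bigr => m _.
by rewrite innerC adjointP.
Qed.

(** The inner product of the preconditioner: tau^-1 on the primal part,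
    sigma^-1 - tau L L^* on the dual part. *)
Definition metric (z z' : X * dirsum U) : R :=
  tau^-1 * '[z.1, z'.1] + \sum_(m < M) (sigma m)^-1 * '[z.2 m, z'.2 m]
  - tau * '[Lstar z.2, Lstar z'.2].

Lemma dual_energy_ge0 u : 0 <= \sum_(m < M) (sigma m)^-1 * '[u m, u m].
Proof. by apply: sumr_ge0 => m _; rewrite mulr_ge0 ?inner_ge0// invr_ge0 ltW. Qed.

(** With y = L^* u, Young's inequality applied to |y|^2, the sum of the
    <L_m y, u_m>, trades the dual energy of u against the sum of the
    sigma_m |L_m y|^2, which the operator norm bounds by a multiple of |y|^2. *)
Lemma step_size_coercive : exists2 kappa, 0 < kappa & forall u : dirsum U,
  tau * '[Lstar u, Lstar u] <= (1 - kappa) * \sum_(m < M) (sigma m)^-1 * '[u m, u m].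
Proof.
move: step_size; set T := (fun x : X => _); set op := opnorm T => op_lt.
have op0 : 0 <= op by exact: opnorm_ge0.
have [K [K0 opK tK]] : exists K, [/\ 0 < K, op <= K & tau * K < 1].
  have ltau : op < tau^-1 by rewrite -(@ltr_pM2l _ tau)// mulfV ?gt_eqF.
  (* the midpoint is positive even when the operator norm vanishes *)
  exists ((op + tau^-1) / 2); split.
  - by rewrite divr_gt0// ltr_wpDl// invr_gt0.
  - by lra.
  - by rewrite mulrC -ltr_pdivlMr// mul1r; lra.
exists (1 - tau * K); first by rewrite subr_gt0.
move=> u; rewrite opprB addrCA subrr addr0 -mulrA ler_pM2l//.
have [C TC] : exists C, forall x, `|T x| <= C * `|x|.
  have [C C0] : exists C : 'I_M -> R, forall m x,
      `|sigma m *: adjoint (L m) (L m x)| <= C m * `|x|.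
    have C m : exists C, forall x, `|sigma m *: adjoint (L m) (L m x)| <= C * `|x|.
      have [K1 K10 LK] := bounded_linear_lipschitz (hL m).
      have [K2 K20 aK] := adjoint_lipschitz (hL m).
      exists (sigma m * (K2 * K1)) => x.
      rewrite normrZ gtr0_norm// -!mulrA ler_pM2l//.
      by rewrite (le_trans (aK _))// ler_pM2l.
    by exists (fun m => projT1 (cid (C m))) => m; exact: (projT2 (cid (C m))).
  exists (\sum_(m < M) C m) => x; rewrite mulr_suml.
  by rewrite (le_trans (ler_norm_sum _ _ _))// ler_sum.
have TZ a x : T (a *: x) = a *: T x.
  rewrite /T scaler_sumr; apply: eq_bigr => m _.
  by rewrite linearZ/= adjointZ// !scalerA mulrC.
move: (Lstar u) (inner_Lstar (Lstar u) u) => y yE.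
have Ty : \sum_(m < M) sigma m * '[L m y, L m y] <= op * '[y, y].
  have -> : \sum_(m < M) sigma m * '[L m y, L m y] = '[T y, y].
    rewrite /T inner_suml; apply: eq_bigr => m _.
    by rewrite innerZl innerC -adjointP.
  rewrite (le_trans (inner_le_norm _ _))// -sqr_norm_inner expr2 mulrA.
  by rewrite ler_wpM2r// (opnorm_ge TZ TC).
have : 2 * '[y, y] <= K * \sum_(m < M) (sigma m)^-1 * '[u m, u m] +
    K^-1 * \sum_(m < M) sigma m * '[L m y, L m y].
  rewrite yE !mulr_sumr -big_split; apply: ler_sum => m _ /=.
  have Ks : 0 < K^-1 * sigma m by rewrite mulr_gt0// invr_gt0.
  have := young (inner_complete (U m)) (L m y) (u m) Ks.
  by rewrite invfM invrK -!mulrA addrC.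
have : K^-1 * \sum_(m < M) sigma m * '[L m y, L m y] <= '[y, y].
  rewrite mulrC ler_pdivrMr// (le_trans Ty)// mulrC ler_wpM2l ?inner_ge0//.
by set a := K^-1 * _; set b := K * _; lra.
Qed.

Lemma metric_coercive : exists2 kappa, 0 < kappa & forall z,
  tau^-1 * '[z.1, z.1] + kappa * \sum_(m < M) (sigma m)^-1 * '[z.2 m, z.2 m]
    <= metric z z.
Proof.
have [k k0 kP] := step_size_coercive; exists k => // z; rewrite /metric.
by have := kP z.2; set Q := \sum_(_ < _) _; lra.
Qed.

Lemma metric_ge_primal z : tau^-1 * '[z.1, z.1] <= metric z z.
Proof.
have [k k0 /(_ z)] := metric_coercive; apply: le_trans.
by rewrite lerDl mulr_ge0 ?dual_energy_ge0// ltW.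
Qed.

Lemma metric_ge_dual : exists2 kappa, 0 < kappa & forall z m,
  kappa * ((sigma m)^-1 * '[z.2 m, z.2 m]) <= metric z z.
Proof.
have [k k0 kP] := metric_coercive; exists k => // z m; apply: le_trans (kP z).
apply: ler_wpDl; first by rewrite mulr_ge0 ?inner_ge0// invr_ge0 ltW.
rewrite ler_pM2l// (bigD1 m)//= lerDl; apply: sumr_ge0 => i _.
by rewrite mulr_ge0 ?inner_ge0// invr_ge0 ltW.
Qed.

Lemma metric_le z : metric z z <=
  tau^-1 * '[z.1, z.1] + \sum_(m < M) (sigma m)^-1 * '[z.2 m, z.2 m].
Proof. by rewrite /metric gerBl mulr_ge0 ?inner_ge0// ltW. Qed.

Lemma metric_complete : complete_dot metric.
Proof.
split.
- move=> y z; rewrite /metric innerC (innerC (Lstar y.2)); congr (_ + _ - _).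
  by apply: eq_bigr => m _; rewrite innerC.
- move=> a x y z; rewrite /metric /= LstarP !innerDl !innerZl.
  under eq_bigr do rewrite dirsumDE dirsumZE innerDl innerZl mulrDr mulrCA.
  by rewrite big_split/= -mulr_sumr; ring.
- move=> z; apply: le_trans (metric_ge_primal z).
  by rewrite mulr_ge0 ?inner_ge0// invr_ge0 ltW.
- move=> [y u] z0; have [k k0 kP] := metric_ge_dual.
  congr pair.
    apply: (dot_eq0 (inner_complete X)).
    have := le_trans (metric_ge_primal _) z0.
    by rewrite pmulr_rle0 ?invr_gt0.
  apply: functional_extensionality_dep => m; apply: (dot_eq0 (inner_complete (U m))).
  have := le_trans (kP _ m) z0.
  by rewrite pmulr_rle0// pmulr_rle0 ?invr_gt0.
- move=> z zc; have [k k0 kP] := metric_ge_dual.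
  have [l1 zl1] : exists l, dot_cvg inner (fun n => (z n).1) l.
    apply: (dot_complete (inner_complete X)) => e e0.
    have [|N zN] := zc (tau^-1 * e); first by rewrite mulr_gt0// invr_gt0.
    exists N => m n Nm Nn; rewrite -(@ler_pM2l _ tau^-1) ?invr_gt0//.
    exact: le_trans (metric_ge_primal (z m - z n)) (zN m n Nm Nn).
  have zl2 m : exists l, dot_cvg inner (fun n => (z n).2 m) l.
    apply: (dot_complete (inner_complete (U m))) => e e0.
    have c0 : 0 < k * (sigma m)^-1 by rewrite mulr_gt0// invr_gt0.
    have [|N zN] := zc (k * (sigma m)^-1 * e); first by rewrite mulr_gt0.
    exists N => i j Ni Nj; rewrite -(ler_pM2l c0) -[leLHS]mulrA.
    exact: le_trans (kP (z i - z j) m) (zN i j Ni Nj).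
  pose l : X * dirsum U := (l1, fun m => projT1 (cid (zl2 m))).
  exists l.
  have h : (fun n => tau^-1 * '[(z n).1 - l1, (z n).1 - l1] +
      \sum_(m < M) (sigma m)^-1 * '[(z n).2 m - l.2 m, (z n).2 m - l.2 m]) @ \oo
      --> tau^-1 * 0 + \sum_(m < M) (sigma m)^-1 * 0.
    apply: cvgD; first exact: cvgMr.
    apply: (@cvg_sumr _ _ (index_enum 'I_M)
      (fun m n => (sigma m)^-1 * '[(z n).2 m - l.2 m, (z n).2 m - l.2 m])) => m.
    by apply: cvgMr; exact: (projT2 (cid (zl2 m))).
  move: h; rewrite mulr0 big1 => [h|m _]; last by rewrite mulr0.
  rewrite addr0 in h; apply: (squeeze_cvgr _ (cvg_cst 0) h).
  apply: nearW => n; rewrite (metric_le (z n - l)) andbT.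
  apply: le_trans (metric_ge_primal _).
  by rewrite mulr_ge0 ?inner_ge0// invr_ge0 ltW.
Qed.

Variables (g : forall m, U m -> \bar R) (h : X -> R^o) (beta : R).
Arguments g : clear implicits.
Hypothesis hg : forall m, Gamma0 (g m).
Hypothesis g_subdiff : forall m, exists p q, subdiff (g m) p q.
Hypothesis h_convex : convex_function [set: X] h.
Hypothesis h_diff : forall x, differentiable h x.
Hypothesis beta_gt0 : 0 < beta.
Hypothesis h_lip : forall x y, `|gradient h x - gradient h y| <= beta * `|x - y|.
Hypothesis tau_lt : tau < 2 / beta.

Let scaled_conj m : U m -> \bar R := fun y => ((sigma m)%:E * conjugate (g m) y)%E.

Lemma conjugate_Gamma0 m : Gamma0 (conjugate (g m)).
Proof.
have [p [q gp]] := g_subdiff m; have [_ gpr _] := hg m.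
exact: Gamma0_conjugate gpr gp.
Qed.

Lemma subdiff_prox_conjugate m w :
  subdiff (conjugate (g m)) (prox (@scaled_conj m) w)
    ((sigma m)^-1 *: (w - prox (@scaled_conj m) w)).
Proof.
have [p [q gp]] := g_subdiff m; have [_ gpr _] := hg m.
have [_ cpr _] := conjugate_Gamma0 m.
apply/subdiff_scale => //; apply: subdiff_prox.
  exact/Gamma0_scale/conjugate_Gamma0.
apply: affinely_minorized_scale => //.
exact: subdiff_minorized cpr (subdiff_conjugate gpr gp).
Qed.

Definition dual_step z : dirsum U := fun m =>
  prox (@scaled_conj m) (z.2 m + sigma m *:
    L m (z.1 - tau *: gradient h z.1 - tau *: Lstar z.2)).

Definition fb_step z : X * dirsum U :=
  (z.1 - tau *: gradient h z.1 - tau *: Lstar (dual_step z), dual_step z).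

Definition saddle_point z : Prop :=
  (forall m, subdiff (conjugate (g m)) (z.2 m) (L m z.1)) /\
  gradient h z.1 + Lstar z.2 = 0.

(** At a fixed point the argument of each proximal map is u_m + sigma_m L_m x. *)
Lemma fb_step_fixedP z : fb_step z = z <-> saddle_point z.
Proof.
case: z => x u; split=> [Tz|[/= gu hu]].
  have u_fix : dual_step (x, u) = u by have := congr1 snd Tz.
  have x_fix : x - tau *: gradient h x - tau *: Lstar u = x.
    by have := congr1 fst Tz; rewrite /fb_step u_fix.
  split=> /= [m|].
    have := subdiff_prox_conjugate (u m + sigma m *: L m x).
    have : dual_step (x, u) m = u m by rewrite u_fix.
    rewrite /dual_step /= x_fix => ->.
    by rewrite addrC addKr scalerA mulVf ?gt_eqF// scale1r.
  move/eqP: x_fix; rewrite -addrA -opprD -scalerDr -subr_eq0 addrAC subrr add0r.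
  by rewrite oppr_eq0 scaler_eq0 gt_eqF//= => /eqP.
have x_fix : x - tau *: gradient h x - tau *: Lstar u = x.
  by rewrite -addrA -opprD -scalerDr hu scaler0 subr0.
have u_fix : dual_step (x, u) = u.
  apply: functional_extensionality_dep => m; rewrite /dual_step /= x_fix.
  apply: prox_of_subdiff.
    by have [] := Gamma0_scale (sigma_gt0 m) (conjugate_Gamma0 m).
  apply/subdiff_scale => //.
  by rewrite addrC addKr scalerA mulVf ?gt_eqF// scale1r.
by rewrite /fb_step u_fix /= x_fix.
Qed.

(** Let e be the increment of [fb_step], r that of the residual and b that of the
    gradient.  Monotonicity of the subdifferentials of the conjugates gives
    metric r e >= <b, e.1>, in which L^* cancels between the two blocks.  Since
    e.1 + r.1 is the increment of the argument, cocoercivity gives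
    <b, e.1> >= |b|^2 / beta - <b, r.1> >= - (beta / 4) |r.1|^2, and |r.1|^2 is at
    most tau (metric r r). *)
Lemma fb_step_averaged z z' e r :
  e = fb_step z - fb_step z' -> r = z - z' - e ->
  - (beta * tau / 4) * metric r r <= metric r e.
Proof.
move=> eE rE.
have [b bE] : exists b, b = gradient h z.1 - gradient h z'.1 by eexists.
have r1E : r.1 = tau *: b + tau *: Lstar e.2.
  have -> : Lstar e.2 = Lstar (dual_step z) - Lstar (dual_step z').
    by rewrite eE -LstarB.
  rewrite bE !scalerBr -(subr_residual z.1 z'.1) rE eE.
  by [].
have step m : 0 <= (sigma m)^-1 * '[e.2 m, r.2 m]
    + '[L m (e.1 - tau *: Lstar r.2), e.2 m].
  have [_ cpr _] := conjugate_Gamma0 m.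
  have := subdiff_monotone cpr
    (subdiff_prox_conjugate (z.2 m + sigma m *:
      L m (z.1 - tau *: gradient h z.1 - tau *: Lstar z.2)))
    (subdiff_prox_conjugate (z'.2 m + sigma m *:
      L m (z'.1 - tau *: gradient h z'.1 - tau *: Lstar z'.2))).
  rewrite -/(dual_step z m) -/(dual_step z' m).
  have scale_step p q y : (sigma m)^-1 *: (p + sigma m *: L m y - q) =
      (sigma m)^-1 *: (p - q) + L m y.
    by rewrite addrAC scalerDr scalerA mulVf ?gt_eqF// scale1r.
  rewrite !scale_step opprD addrACA -scalerBr -linearB/= subrBB.
  have -> : dual_step z m - dual_step z' m = e.2 m by rewrite eE.
  have -> : z.2 m - z'.2 m - e.2 m = r.2 m by rewrite rE.
  set y := _ - _; have -> : y = e.1 - tau *: Lstar r.2.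
    have -> : Lstar r.2 = (Lstar z.2 - Lstar z'.2) -
        (Lstar (dual_step z) - Lstar (dual_step z')).
      by rewrite rE eE -!LstarB.
    have -> : e.1 = (fb_step z).1 - (fb_step z').1 by rewrite eE.
    by rewrite !scalerBr /y /fb_step /fst -subr_exchange.
  by rewrite innerDr innerZr [X in _ + X]innerC.
have {}step : 0 <= \sum_(m < M) (sigma m)^-1 * '[e.2 m, r.2 m]
    + '[e.1 - tau *: Lstar r.2, Lstar e.2].
  by rewrite inner_Lstar -big_split; apply: sumr_ge0 => m _; exact: step.
have coco : `|b| ^+ 2 <= beta * '[b, e.1 + r.1].
  have -> : e.1 + r.1 = z.1 - z'.1 by rewrite rE /= addrC subrK.
  by rewrite bE; exact: (gradient_cocoercive h_convex h_diff _ _ beta_gt0 h_lip).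
have primal : - (beta / 4) * '[r.1, r.1] <= '[b, e.1].
  have b0 : 0 < 2 / beta by rewrite divr_gt0.
  have := young (inner_complete X) b r.1 b0.
  move: coco; rewrite sqr_norm_inner innerDr mulrC -ler_pdivrMr// invf_div.
  have -> : 2 / beta * '[b, b] = 2 * ('[b, b] / beta) by ring.
  have -> : beta / 2 * '[r.1, r.1] = 2 * (beta / 4 * '[r.1, r.1]) by field.
  by rewrite mulNr; lra.
have resid : beta / 4 * '[r.1, r.1] <= beta * tau / 4 * metric r r.
  rewrite (_ : beta * tau / 4 = beta / 4 * tau); last by ring.
  rewrite -[leRHS]mulrA ler_pM2l ?divr_gt0//.
  rewrite -(@ler_pM2l _ tau^-1) ?invr_gt0// [leRHS]mulrA mulVf ?gt_eqF// mul1r.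
  exact: metric_ge_primal.
apply: (@le_trans _ _ '[b, e.1]); first by move: primal; rewrite !mulNr; lra.
rewrite /metric.
move: step; rewrite innerBl innerZl (innerC e.1) => step.
have -> : tau^-1 * '[r.1, e.1] = '[b, e.1] + '[Lstar e.2, e.1].
  by rewrite r1E innerDl !innerZl mulrDr !mulrA mulVf ?gt_eqF// !mul1r.
have -> : \sum_(m < M) (sigma m)^-1 * '[r.2 m, e.2 m] =
    \sum_(m < M) (sigma m)^-1 * '[e.2 m, r.2 m].
  by apply: eq_bigr => m _; rewrite innerC.
by lra.
Qed.

Local Notation delta := (2 - tau * beta / 2).

Lemma delta_gt1 : 1 < delta.
Proof. by move: tau_lt; rewrite ltr_pdivlMr//; lra. Qed.

Definition relaxed_step z : X * dirsum U := z + delta *: (fb_step z - z).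

(** Nonexpansiveness after relaxation by delta means
    2 metric (z - z') r >= delta (metric r r) for the residual increment r, and the
    value of delta is the one that [fb_step_averaged] yields. *)
Lemma relaxed_step_nonexpansive : nonexpansive metric relaxed_step.
Proof.
move=> z z'; have mc := metric_complete.
set e := fb_step z - fb_step z'.
have := fb_step_averaged (erefl e) (erefl (z - z' - e)).
have -> : relaxed_step z - relaxed_step z' = (z - z') - delta *: (z - z' - e).
  by rewrite -scalerN opprB /relaxed_step opprD addrACA -scalerBr [in LHS]subrBB.
move: e (z - z') => e d.
have [r rE] : exists r, r = d - e by exists (d - e).
have -> : d = r + e by rewrite rE subrK.
rewrite addrK => avg.
rewrite (sqdotB mc) (sqdotZ mc) (dotZr mc) (dotDl mc r e r) (dotC mc e r).
have d0 : 0 < delta by exact: lt_trans delta_gt1.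
have : 0 <= delta * (metric r e + beta * tau / 4 * metric r r).
  by rewrite mulr_ge0 ?(ltW d0)//; lra.
by lra.
Qed.

Lemma relaxed_step_fixedP z : relaxed_step z = z <-> saddle_point z.
Proof.
rewrite -fb_step_fixedP /relaxed_step.
split=> [|->]; last by rewrite subrr scaler0 addr0.
move=> /eqP; rewrite -subr_eq0 addrC addKr scaler_eq0 gt_eqF/=; last first.
  exact: lt_trans delta_gt1.
by rewrite subr_eq0 => /eqP.
Qed.

(** Pairing with v in the first block is a continuous functional for [metric],
    hence represented in it by Riesz; the same holds for each dual block. *)
Lemma metric_weak_primal (z : nat -> X * dirsum U) c :
  (forall y, (fun n => metric (z n) y) @ \oo --> metric c y) ->
  weakly_cvg inner (fun n => (z n).1) c.1.
Proof.
move=> zc v; have mc := metric_complete.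
have [||w wP] := @riesz _ _ _ mc (fun y => '[y.1, v]) (tau * '[v, v]).
- by move=> a x y; rewrite /= innerDl innerZl.
- move=> y; rewrite (le_trans (cauchy_schwarz (inner_complete X) _ _))//.
  rewrite mulrC -mulrA mulrCA ler_wpM2l ?inner_ge0//.
  rewrite -(@ler_pM2l _ tau^-1) ?invr_gt0// [leRHS]mulrA mulVf ?gt_eqF// mul1r.
  exact: metric_ge_primal.
have {}wP y : '[y.1, v] = metric y w by rewrite (dotC mc) -wP.
rewrite (wP c) (_ : (fun n => _) = (fun n => metric (z n) w)); first exact: zc.
by apply/funext => n; exact: wP.
Qed.

Lemma metric_weak_dual (z : nat -> X * dirsum U) c :
  (forall y, (fun n => metric (z n) y) @ \oo --> metric c y) ->
  weakly_cvg (@prod_inner R M U) (fun n => (z n).2) c.2.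
Proof.
move=> zc v; have mc := metric_complete; have [k k0 kP] := metric_ge_dual.
apply: (@cvg_sumr _ _ (index_enum 'I_M) (fun m n => '[(z n).2 m, v m])) => m.
have ks : 0 < k * (sigma m)^-1 by rewrite mulr_gt0// invr_gt0.
have [||w wP] := @riesz _ _ _ mc (fun y => '[y.2 m, v m])
  ((k * (sigma m)^-1)^-1 * '[v m, v m]).
- by move=> a x y; rewrite /= dirsumDE dirsumZE innerDl innerZl.
- move=> y; rewrite (le_trans (cauchy_schwarz (inner_complete (U m)) _ _))//.
  rewrite mulrC -mulrA mulrCA ler_wpM2l ?inner_ge0//.
  rewrite -(ler_pM2l ks) [leRHS]mulrA mulfV ?gt_eqF// mul1r -mulrA.
  exact: kP.
have {}wP y : '[y.2 m, v m] = metric y w by rewrite (dotC mc) -wP.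
rewrite (wP c) (_ : (fun n => _) = (fun n => metric (z n) w)); first exact: zc.
by apply/funext => n; exact: wP.
Qed.

Lemma saddle_point_primal x u : saddle_point (x, u) ->
  argmin (fun y : X => \sum_(m < M) g m (L m y) + (h y)%:E)%E x.
Proof.
move=> [/= gu hu] y.
have gLy m : (g m (L m x) + '[L m y - L m x, u m]%:E <= g m (L m y))%E.
  have [p [q gp]] := g_subdiff m.
  exact: (subdiff_conjugateK (hg m) gp (gu m)).
have hy : ((h x)%:E + '[y - x, gradient h x]%:E <= (h y)%:E)%E.
  by rewrite -EFinD lee_fin; exact: gradient_ineq.
apply: le_trans (leeD (lee_sum _ (fun m _ => gLy m)) hy).
rewrite big_split/= sumEFin.
have zero : \sum_(m < M) '[L m y - L m x, u m] + '[y - x, gradient h x] = 0.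
  under eq_bigr do rewrite -linearB/=.
  rewrite -inner_Lstar -innerDr [Lstar u + _]addrC hu innerC.
  exact: dot0l (inner_complete X) _.
by rewrite addeACA -EFinD zero adde0.
Qed.

(** The pair (x, grad h(x)) realises equality in the Fenchel-Young inequality of h. *)
Lemma saddle_point_dual x u : saddle_point (x, u) ->
  argmin (fun v : forall m, U m =>
    \sum_(m < M) conjugate (g m) (v m)
    + conjugate (EFin \o h) (- \sum_(m < M) adjoint (L m) (v m))%R)%E u.
Proof.
move=> [/= gu hu] v; rewrite -!/(Lstar _).
have hLu : - Lstar u = gradient h x by apply/eqP; rewrite eq_sym -addr_eq0 hu.
have hstar : conjugate (EFin \o h) (- Lstar u) = ('[x, - Lstar u] - h x)%:E.
  apply: conjugate_subdiff; first by split=> // ; exists x.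
  by move=> y; rewrite hLu /= -EFinD lee_fin; exact: gradient_ineq.
have hv : (('[x, - Lstar v] - h x)%:E <= conjugate (EFin \o h) (- Lstar v)%R)%E.
  by rewrite EFinB; exact: conjugate_ge.
apply: le_trans (leeD (lee_sum _ (fun m _ => gu m (v m))) hv).
rewrite big_split/= sumEFin hstar -addeA -EFinD leeD2l// lee_fin.
have -> : \sum_(m < M) '[v m - u m, L m x] = '[x, Lstar ((v : dirsum U) - u)].
  by rewrite inner_Lstar; apply: eq_bigr => m _; rewrite innerC.
by rewrite LstarB innerBr !innerNr; lra.
Qed.

End primal_dual.

(** * Convergence *)

Theorem theorem9p3 (R : realType) (M : nat) (hM : (1 <= M)%N)
  (X : hilbertType R) (U : 'I_M -> hilbertType R)
  (g : forall m, U m -> \bar R)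
  (hg : forall m, Gamma0 (g m))
  (L : forall m, {linear X -> U m})
  (hL : forall m, bounded_fun_norm (L m))
  (h : X -> R^o)
  (h_convex : convex_function [set: X] h)
  (h_diff : forall x, differentiable h x)
  (beta : R) (hbeta : 0 < beta)
  (h_lip : beta.-lipschitz (gradient h))
  (h_sol : exists x : X,
     [set \sum_(m < M) adjoint (L m) (v m) + gradient h x
       | v in [set v : forall m, U m | forall m, subdiff (g m) (L m x) (v m)]]
     0)
  (tau : R) (htau : 0 < tau < 2 / beta)
  (sigma : 'I_M -> R) (hsigma : forall m, 0 < sigma m)
  (h_norm : tau * opnorm (fun x : X =>
     \sum_(m < M) sigma m *: adjoint (L m) (L m x)) < 1)
  (delta : R) (hdelta : delta = 2 - tau * beta / 2)
  (rho : nat -> R) (hrho : forall i, 0 <= rho i <= delta)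
  (hrho_sum : (\sum_(0 <= i <oo) (rho i * (delta - rho i))%:E = +oo)%E)
  (x s a : nat -> X) (u : nat -> forall m, U m)
  (hs0 : s 0%N = x 0%N + tau *: \sum_(m < M) adjoint (L m) (u 0%N m))
  (ha : forall i, a i = x i - tau *: gradient h (x i) - s i)
  (hs : forall i, s i.+1 = s i + rho i *: a i)
  (hu : forall i m, u i.+1 m = u i m + rho i *:
     (prox (fun y => ((sigma m)%:E * conjugate (g m) y)%E)
        (u i m + sigma m *: L m (x i + a i)) - u i m))
  (hx : forall i,
     x i.+1 = s i.+1 - tau *: \sum_(m < M) adjoint (L m) (u i.+1 m)) :
  (exists xsol : X,
     argmin (fun y : X => \sum_(m < M) g m (L m y) + (h y)%:E)%E xsol /\
     weakly_cvg inner x xsol) /\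
  (exists usol : forall m, U m,
     argmin (fun v : forall m, U m =>
       \sum_(m < M) conjugate (g m) (v m)
       + conjugate (EFin \o h) (- \sum_(m < M) adjoint (L m) (v m))%R)%E usol /\
     weakly_cvg (@prod_inner R M U) u usol).
Proof.
have [tau_gt0 tau_lt] := andP htau.
have lip y z : `|gradient h y - gradient h z| <= beta * `|y - z|.
  by apply: (h_lip (y, z)); split.
have [xs [v gv /= hv]] := h_sol.
have g_sub m : exists p q, subdiff (g m) p q by exists (L m xs), (v m).
have saddle : saddle_point L g h (xs, v : dirsum U).
  split=> [m /=|]; last by rewrite addrC.
  by have [_ gpr _] := hg m; exact: subdiff_conjugate.
pose N := relaxed_step L tau sigma g h beta.
have Nfix z : N z = z <-> saddle_point L g h z by exact: relaxed_step_fixedP.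
have delta1 : 1 < delta by rewrite hdelta; exact: (delta_gt1 hbeta tau_lt).
have delta0 : 0 < delta by exact: lt_trans delta1.
pose ud n : dirsum U := u n.
pose z n : X * dirsum U := (x n, ud n).
have s_inv i : s i = x i + tau *: Lstar L (ud i).
  by case: i => [|i]; [exact: hs0 | rewrite hx subrK].
have xa i : x i + a i = x i - tau *: gradient h (x i) - tau *: Lstar L (ud i).
  by rewrite ha s_inv opprD addrACA subrr add0r addrA.
have u_step i : ud i.+1 = rho i *: (dual_step L tau sigma g h (z i) - ud i) + ud i.
  by apply: functional_extensionality_dep => m; rewrite /ud hu xa addrC.
have zS i : z i.+1 = z i + (rho i / delta) *: (N (z i) - z i).
  have -> : N (z i) - z i = delta *: (fb_step L tau sigma g h (z i) - z i).
    by rewrite hdelta /N /relaxed_step [LHS]addrC addKr.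
  rewrite scalerA mulfVK ?gt_eqF//; congr pair; last by rewrite u_step addrC.
  have := xa i; rewrite -addrA => /addrI ai.
  apply: inner_eqr => w; rewrite hx hs s_inv -/(Lstar L (ud i.+1)) u_step.
  rewrite (LstarP hL) (LstarB hL) ai /=.
  rewrite !(innerDr, innerNr, innerZr, innerBr); ring.
have [||c Nc cP] := krasnoselskii_mann (metric_complete hL tau_gt0 hsigma h_norm)
    (relaxed_step_nonexpansive hL tau_gt0 hsigma h_norm hg g_sub h_convex h_diff
       hbeta lip tau_lt)
    ((Nfix _).2 saddle) _ _ zS.
- move=> i; have /andP[r0 r1] := hrho i.
  by rewrite divr_ge0 ?(ltW delta0)//= ler_pdivrMr// mul1r.
- move=> A.
  have rd i : 0 <= rho i * (delta - rho i).
    by have /andP[r0 r1] := hrho i; rewrite mulr_ge0// subr_ge0.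
  have [n An] := nneseries_pinfty_unbounded rd hrho_sum (A * delta ^+ 2).
  exists n; rewrite -(@ler_pM2r _ (delta ^+ 2)) ?exprn_gt0//.
  apply: le_trans An _; rewrite mulr_suml; apply: ler_sum => i _.
  by rewrite le_eqVlt; apply/orP; left; apply/eqP; field; rewrite gt_eqF.
have c_saddle := (Nfix c).1 Nc; split.
- exists c.1; split; last exact: (metric_weak_primal hL tau_gt0 hsigma h_norm cP).
  apply: (saddle_point_primal hL hg g_sub h_convex h_diff (u := c.2)).
  by case: (c) c_saddle.
- exists c.2; split; last exact: (metric_weak_dual hL tau_gt0 hsigma h_norm cP).
  apply: (saddle_point_dual hL h_convex h_diff (x := c.1)).
  by case: (c) c_saddle.
Qed.
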